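(* Let $C$ be a pointed sharp Euler $K$-coalgebra with a fixed decomposition $\mathrm{soc}\,{}_CC=\bigoplus_{j\in I_C}S(j)$, and let $\mathbf{\Phi}_C:\mathbb{Z}^{I_C}_\blacktriangleright\to\mathbb{Z}^{I_C}_\blacktriangleleft$ and $\mathbf{\Phi}^-_C:\mathbb{Z}^{I_C}_\blacktriangleleft\to\mathbb{Z}^{I_C}_\blacktriangleright$ be the Coxeter transformations of $C$. (a) Let $M$ be an indecomposable left $C$-comodule in $C\text{-}\mathrm{Comod}^\bullet_{fc}$ such that $\mathrm{inj.dim}\,M=1$ and $\mathrm{Hom}_C(C,M)=0$. If $$0\to M\to M'\to \tau^-_CM\to 0$$ is the unique almost split sequence in $C\text{-}\mathrm{Comod}_{fc}$ starting at $M$, with the indecomposable comodule $\tau_C^-M$ lying in $C\text{-}\mathrm{comod}_{f\mathcal P}$, then $$\mathbf{dim}\,\tau^-_CM=\mathbf{\Phi}^-_C(\mathbf{dim}\,M).$$ (b) Let $N$ be an indecomposable non-projective left $C$-comodule in $C\text{-}\mathrm{comod}_{f\mathcal P}\subseteq C\text{-}\mathrm{Comod}_{fc}$ such that the right $C$-comodule $DN$ satisfies $\mathrm{inj.dim}\,DN=1$ and $\mathrm{Hom}_C(C,DN)=0$. If $$0\to\tau_CN\to N'\to N\to 0$$ is the unique almost split sequence in $C\text{-}\mathrm{Comod}_{fc}$ ending at $N$, with the indecomposable comodule $\tau_CN$ lying in $C\text{-}\mathrm{Comod}^\bullet_{fc}$, then $$\mathbf{dim}\,\tau_CN=\mathb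f{\Phi}_C(\mathbf{dim}\,N).$$
   Context: $K$ is an arbitrary field, $C$ a $K$-coalgebra, $D(-)=\mathrm{Hom}_K(-,K)$. $C\text{-}\mathrm{Comod}$ (resp. $C\text{-}\mathrm{comod}$) is the category of (resp. finite-dimensional) left $C$-comodules; $C^{op}\text{-}\mathrm{Comod}$, $C^{op}\text{-}\mathrm{comod}$ are the corresponding categories of right $C$-comodules. $D$ gives a duality between $C\text{-}\mathrm{comod}$ and $C^{op}\text{-}\mathrm{comod}$. $C^*=\mathrm{Hom}_K(C,K)$ is the convolution algebra, a pseudocompact algebra; left (right) $C$-comodules are identified with rational right (left) $C^*$-modules. $C^*\text{-PC}$ and $\mathrm{PC}\text{-}C^*$ are the categories of pseudocompact left, respectively right, $C^*$-modules. $\widetilde D(M)=M^*$ defines dualities $C\text{-}\mathrm{Comod}\to C^*\text{-PC}$ and $C^{op}\text{-}\mathrm{Comod}\to \mathrm{PC}\text{-}C^*$, with quasi-inverse $Y\mapsto Y^\circ$, the space of continuous $K$-linear maps $Y\to K$. A comodule is socle-finite if its socle is finite-dimensional. $C\text{-inj}$ is the category of socle-finite injective left $C$-comodules. $C\text{-}\mathrm{Comod}_{fc}$ is the full subcategory of $C\text{-}\mathrm{Comod}$ of finitely copresented comodules, i.e. those $M$ with an exact sequence $0\to M\to E_0\xrightarrow{g}E_1$ with $E_0,E_1$ in $C\text{-inj}$. The contravariant functor $\nabla_C$ is $\nabla_CM=(\mathrm{hom}_{C^*}(M^*,C^* ))^\circ$ ($\mathrm{hom}_{C^*}$ denotes continuous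 homomorphisms); it restricts to a duality $C\text{-inj}\to C^{op}\text{-inj}$ with $\nabla_C(eC)\cong Ce$ for idempotents $e\in C^*$, and $\nabla_{C^{op}}$ is defined analogously. For $M$ in $C\text{-}\mathrm{Comod}_{fc}$ with a minimal socle-finite injective copresentation $0\to M\to E_0\xrightarrow{g}E_1$ ($E_0,E_1$ in $C\text{-inj}$), $\mathrm{Tr}_CM=\mathrm{Ker}[\nabla_CE_1\xrightarrow{\nabla_C(g)}\nabla_CE_0]$, an object of $C^{op}\text{-}\mathrm{Comod}_{fc}$; $\mathrm{Tr}_{C^{op}}$ is defined analogously. $C\text{-}\mathrm{Comod}^\bullet_{fc}$ is the full subcategory of those $M$ in $C\text{-}\mathrm{Comod}_{fc}$ with $\dim_K\mathrm{Tr}_CM<\infty$. $C\text{-}\mathrm{comod}_{f\mathcal P}$ is the full subcategory of $C\text{-}\mathrm{comod}$ of those $N$ which, as right $C^*$-modules, have a minimal presentation $P_1\to P_0\to N\to0$ with $P_0,P_1$ top-finite projective in $\mathrm{PC}\text{-}C^*$ (equivalently, $DN$ is a finitely copresented right comodule). The Auslander–Reiten translates are $\tau_C^-=D\,\mathrm{Tr}_C$ on $C\text{-}\mathrm{Comod}^\bullet_{fc}$ and $\tau_C=\mathrm{Tr}_{C^{op}}D$ on $C\text{-}\mathrm{comod}_{f\mathcal P}$. $C$ is pointed if all simple comodules are one-dimensional. Then $\mathrm{soc}\,{}_CC=\bigoplus_{j\in I_C}S(j)$ with $\{S(j)\}_{j\in I_C}$ a set of representatives of the simple left $C$-comodules;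 $E(j)$ is the injective envelope of $S(j)$, $\widehat S(j)=DS(j)$, $\widehat E(j)=\nabla_C(E(j))$ is the injective envelope of $\widehat S(j)$ in right comodules. Primitive idempotents $e_j\in C^*$ are fixed with $E(j)\cong e_jC$, $\widehat E(j)\cong Ce_j$. The dimension vector of a left comodule $M$ is $\mathbf{dim}\,M=[\dim_KMe_j]_{j\in I_C}$, with $\dim_K Me_j=\dim_K\mathrm{Hom}_C(M,E(j))$ the multiplicity of $S(j)$ in $M$; for a right comodule $X$ similarly $\mathbf{dim}\,X=[\dim_K\mathrm{Hom}_{C}(X,\widehat E(j))]_{j\in I_C}$. $C$ is computable if $\dim_K\mathrm{Hom}_C(E',E'')<\infty$ for all indecomposable injective left comodules $E',E''$. $C$ is a left (resp. right) sharp Euler coalgebra if it is computable and every simple left (resp. right) comodule $S$ has a finite injective resolution $0\to S\to E_0\to\cdots\to E_n\to0$ with all $E_m$ socle-finite. $C$ is a sharp Euler coalgebra if it is both left and right sharp Euler and $\dim_K\mathrm{Ext}^m_C(S,S')=\dim_K\mathrm{Ext}^m_{C^{op}}(DS',DS)$ for all $m\ge0$ and all simple left $C$-comodules $S,S'$. The Cartan matrix is $\mathfrak c_C=[\mathbf c_{ij}]_{i,j\in I_C}$, $\mathbf c_{ij}=\dim_Ke_iCe_j$, whose $i$-th row is $\mathbf{dim}\,E(i)$. For $C$ pointed sharp Euler, $\mathfrak c_C^{-1}$ denotes its row-finite and column-finite two-sided inverse with $(i,j)$ entry $\sum_{m\ge0}(-1)^md^{(i)}_{mj}$, where $d^{(i)}_{mj}$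 is the multiplicity of $E(j)$ in the $m$-th term of a minimal injective resolution of $S(i)$; $\mathfrak c_C^{-tr}=(\mathfrak c_C^{-1})^{tr}$. $\mathbb{Z}^{I_C}_\blacktriangleright$ and $\mathbb{Z}^{I_C}_\blacktriangleleft$ are the subgroups of $\mathbb{Z}^{I_C}$ generated by $\{\mathbf{dim}\,\widehat E(a)\}_{a\in I_C}$ and by $\{\mathbf{dim}\,E(a)\}_{a\in I_C}$, respectively. The Coxeter transformations are $\mathbf{\Phi}_C(x)=-(x\cdot\mathfrak c_C^{-tr})\cdot\mathfrak c_C$ for $x\in\mathbb{Z}^{I_C}_\blacktriangleright$ and $\mathbf{\Phi}_C^-(y)=-(y\cdot\mathfrak c_C^{-1})\cdot\mathfrak c_C^{tr}$ for $y\in\mathbb{Z}^{I_C}_\blacktriangleleft$ (vectors are row vectors). *)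

(* Defs.v *)
From HB Require Import structures.
From mathcomp Require Import all_boot all_algebra.
From mathcomp Require Import generic_quotient.
From mathcomp Require Import boolp classical_sets functions cardinality fsbigop.

Set Implicit Arguments.
Unset Strict Implicit.
Unset Printing Implicit Defensive.

Import GRing.Theory.
Local Open Scope classical_set_scope.
Local Open Scope ring_scope.
Local Open Scope quotient_scope.

(** * Linear algebra over a field, in arbitrary dimension *)

Section Subspaces.
Variables (K : fieldType) (V : lmodType K).

Definition subspace (P : set V) : Prop :=
  P 0 /\ forall (a : K) x y, P x -> P y -> P (a *: x + y).

Definition sub_pred (P : set V) (hP : subspace P) : {pred V} := fun x => `[< P x >].

Fact sub_pred_closed P (hP : subspace P) : submod_closed (sub_pred hP).
Proof.
split; first by apply/asboolP; case: hP.
by move=> a x y /asboolP Px /asboolP Py; apply/asboolP; apply: (hP.2).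
Qed.

HB.instance Definition _ P (hP : subspace P) :=
  GRing.isSubmodClosed.Build K V (sub_pred hP) (sub_pred_closed hP).

Record sub_space (P : set V) (hP : subspace P) : Type :=
  SubSpace { sub_val :> V; sub_valP : sub_val \in sub_pred hP }.

Variables (P : set V) (hP : subspace P).

HB.instance Definition _ := [isSub for @sub_val P hP].
HB.instance Definition _ := [Choice of sub_space hP by <:].
HB.instance Definition _ := [SubChoice_isSubLmodule of sub_space hP by <:].

Definition in_sub (x : V) (Px : P x) : sub_space hP := SubSpace (hP := hP) (asboolT Px).

End Subspaces.

(** Elements of [V (x) W] are finite formal sums of pairs, two of them being identified
    when every bilinear map takes the same value on both. *)
Section Tensor.
Variables (K : fieldType) (V W : lmodType K).

Definition bilin (U : lmodType K) (b : V -> W -> U) : Prop :=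
  (forall w, linear (b^~ w)) /\ (forall v, linear (b v)).

Definition tsum (U : lmodType K) (b : V -> W -> U) (s : seq (V * W)) : U :=
  \sum_(p <- s) b p.1 p.2.

Definition tens_rel (s t : seq (V * W)) : bool :=
  `[< forall (U : lmodType K) (b : V -> W -> U), bilin b -> tsum b s = tsum b t >].

Fact tens_rel_equiv : equiv_class_of tens_rel.
Proof.
split=> [s|s t|t s u].
- by apply/asboolP.
- by apply/asbool_equiv_eq; split=> h U b hb; rewrite h.
- by move=> /asboolP h1 /asboolP h2; apply/asboolP => U b hb; rewrite h1 // h2.
Qed.

Canonical tens_equiv := EquivRelPack tens_rel_equiv.
Definition tens := {eq_quot tens_equiv}.
HB.instance Definition _ := Choice.on tens.
HB.instance Definition _ := EqQuotient.on tens.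

Definition tlift (U : lmodType K) (b : V -> W -> U) (T : tens) : U := tsum b (repr T).

Lemma tlift_pi (U : lmodType K) (b : V -> W -> U) s :
  bilin b -> tlift b (\pi_tens s) = tsum b s.
Proof.
move=> hb; have /eqquotP/asboolP h : repr (\pi_tens s) = s %[mod tens] by rewrite reprK.
exact: h.
Qed.

Lemma tens_ext (T T' : tens) :
  (forall (U : lmodType K) (b : V -> W -> U), bilin b -> tlift b T = tlift b T') ->
  T = T'.
Proof.
move=> h; rewrite -[T]reprK -[T']reprK; apply/eqquotP; apply/asboolP => U b hb.
exact: h.
Qed.

Definition tens0 : tens := \pi_tens [::].
Definition tens_add (T T' : tens) : tens := \pi_tens (repr T ++ repr T').
Definition tens_scale (a : K) (T : tens) : tens :=
  \pi_tens [seq (a *: p.1, p.2) | p <- repr T].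

Lemma tlift0_ (U : lmodType K) (b : V -> W -> U) : bilin b -> tlift b tens0 = 0.
Proof. by move=> hb; rewrite tlift_pi // /tsum big_nil. Qed.

Lemma tliftD_ (U : lmodType K) (b : V -> W -> U) T T' :
  bilin b -> tlift b (tens_add T T') = tlift b T + tlift b T'.
Proof. by move=> hb; rewrite tlift_pi // /tsum big_cat. Qed.

Lemma tliftZ_ (U : lmodType K) (b : V -> W -> U) a T :
  bilin b -> tlift b (tens_scale a T) = a *: tlift b T.
Proof.
move=> hb; rewrite tlift_pi // /tsum big_map /= scaler_sumr.
apply: eq_bigr => p _; have := hb.1 p.2 a p.1 0.
have b0 : b 0 p.2 = 0.
  have := hb.1 p.2 1 0 0; rewrite /= !scale1r addr0 => /eqP.
  by rewrite -subr_eq subrr => /eqP.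
by rewrite /= b0 !addr0.
Qed.

Fact tens_addA : associative tens_add.
Proof. by move=> x y z; apply: tens_ext => U b hb; rewrite !tliftD_ // addrA. Qed.
Fact tens_addC : commutative tens_add.
Proof. by move=> x y; apply: tens_ext => U b hb; rewrite !tliftD_ // addrC. Qed.
Fact tens_add0 : left_id tens0 tens_add.
Proof. by move=> x; apply: tens_ext => U b hb; rewrite tliftD_ // tlift0_ // add0r. Qed.
Fact tens_addN : left_inverse tens0 (tens_scale (-1)) tens_add.
Proof.
by move=> x; apply: tens_ext => U b hb; rewrite tliftD_ // tliftZ_ // tlift0_ // scaleN1r addNr.
Qed.

HB.instance Definition _ :=
  GRing.isZmodule.Build tens tens_addA tens_addC tens_add0 tens_addN.

Fact tens_scaleA a a' (T : tens) : tens_scale a (tens_scale a' T) = tens_scale (a * a') T.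
Proof. by apply: tens_ext => U b hb; rewrite !tliftZ_ // scalerA. Qed.
Fact tens_scale1 : left_id 1 tens_scale.
Proof. by move=> T; apply: tens_ext => U b hb; rewrite !tliftZ_ // scale1r. Qed.
Fact tens_scaleDr : right_distributive tens_scale +%R.
Proof.
move=> a x y; apply: tens_ext => U b hb.
by rewrite tliftZ_ // !tliftD_ // !tliftZ_ // scalerDr.
Qed.
Fact tens_scaleDl T : {morph tens_scale^~ T : a a' / a + a'}.
Proof.
move=> a a'; apply: tens_ext => U b hb.
by rewrite tliftZ_ // tliftD_ // !tliftZ_ // scalerDl.
Qed.

HB.instance Definition _ := GRing.Zmodule_isLmodule.Build K tens
  tens_scaleA tens_scale1 tens_scaleDr tens_scaleDl.

Definition tmk (v : V) (w : W) : tens := \pi_tens [:: (v, w)].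

Lemma tlift_linear (U : lmodType K) (b : V -> W -> U) : bilin b -> linear (tlift b).
Proof. by move=> hb a x y; rewrite [LHS]tliftD_ // [tlift b _]tliftZ_. Qed.

Lemma tlift_mk (U : lmodType K) (b : V -> W -> U) v w : bilin b -> tlift b (tmk v w) = b v w.
Proof. by move=> hb; rewrite tlift_pi // /tsum big_seq1. Qed.

Lemma tmk_bilin : bilin tmk.
Proof.
split=> [w a x y|v a x y]; apply: tens_ext => U b hb; rewrite tliftD_ //.
- by rewrite [tlift b (_ *: _)]tliftZ_ // !tlift_mk // hb.1.
- by rewrite [tlift b (_ *: _)]tliftZ_ // !tlift_mk // hb.2.
Qed.

Lemma tens_sum (T : tens) : T = \sum_(p <- repr T) tmk p.1 p.2.
Proof.
apply: tens_ext => U b hb; rewrite {1}/tlift /tsum.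
pose F := GRing.isLinear.Build K _ _ _ (tlift b) (tlift_linear hb).
pose f : {linear tens -> U} := HB.pack (tlift b) F.
rewrite -[RHS]/(f _) linear_sum; apply: eq_bigr => p _.
by rewrite /f /= tlift_mk.
Qed.

Lemma tens_lin_ext (U : lmodType K) (f g : tens -> U) :
  linear f -> linear g -> (forall v w, f (tmk v w) = g (tmk v w)) -> f =1 g.
Proof.
move=> hf hg h T; rewrite (tens_sum T).
pose F := GRing.isLinear.Build K _ _ _ f hf.
pose G := GRing.isLinear.Build K _ _ _ g hg.
pose f' : {linear tens -> U} := HB.pack f F.
pose g' : {linear tens -> U} := HB.pack g G.
rewrite -[LHS]/(f' _) -[RHS]/(g' _) !linear_sum; apply: eq_bigr => p _.
exact: h.
Qed.

End Tensor.

Section LinearForms.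
Variables (K : fieldType) (V : lmodType K).

Fact linear_subspace (U : lmodType K) : subspace (fun f : V -> U => linear f).
Proof.
split=> [a x y|a f g hf hg b x y]; first by rewrite /= scaler0 addr0.
have E h z : (a *: f + h) z = a *: f z + h z by [].
rewrite !E hf hg !scalerDr !scalerA [a * b]mulrC -!addrA; congr (_ + _).
by rewrite addrCA.
Qed.

Definition dual := sub_space (linear_subspace K^o).
HB.instance Definition _ := GRing.Lmodule.on dual.
Definition dual_fun (f : dual) : V -> K := sub_val f.
Coercion dual_fun : dual >-> Funclass.

Lemma dual_linear (f : dual) : linear (dual_fun f : V -> K^o).
Proof. exact/asboolP/(sub_valP f). Qed.

Lemma dual_ext (f g : dual) : f =1 g -> f = g.
Proof. by move=> h; apply/val_inj/funext. Qed.

Lemma dual_addE (a : K) (f g : dual) x : (a *: f + g : dual) x = a * f x + g x.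
Proof. by []. Qed.

End LinearForms.

Definition to_linear (K : fieldType) (U V : lmodType K) (f : U -> V) (hf : linear f) :
  {linear U -> V} := HB.pack f (GRing.isLinear.Build K U V _ f hf).

Section TensorMaps.
Variables (K : fieldType).
Implicit Types U V W X Y Z : lmodType K.

Definition tlin V W U (b : V -> W -> U) (hb : bilin b) : {linear tens V W -> U} :=
  to_linear (tlift_linear hb).

Lemma tlinE V W U (b : V -> W -> U) (hb : bilin b) v w : tlin hb (tmk v w) = b v w.
Proof. exact: tlift_mk. Qed.

Lemma tens_lin_eq V W U (f g : {linear tens V W -> U}) :
  (forall v w, f (tmk v w) = g (tmk v w)) -> f =1 g.
Proof. by move=> h; apply: (tens_lin_ext _ _ h) => a x y; rewrite linearP. Qed.

Fact tmap_bilin V W X Y (f : {linear V -> X}) (g : {linear W -> Y}) :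
  bilin (fun v w => tmk (f v) (g w)).
Proof.
by split=> [w a x y|v a x y]; rewrite linearP; [rewrite (tmk_bilin _ _).1|rewrite (tmk_bilin _ _).2].
Qed.

Definition tmap V W X Y (f : {linear V -> X}) (g : {linear W -> Y}) :
  tens V W -> tens X Y := tlift (fun v w => tmk (f v) (g w)).
HB.instance Definition _ V W X Y (f : {linear V -> X}) (g : {linear W -> Y}) :=
  GRing.isLinear.Build K _ _ _ (tmap f g) (tlift_linear (tmap_bilin f g)).

Fact tswap_bilin V W : bilin (fun (v : V) (w : W) => tmk w v).
Proof. by split=> [? ? ? ?|? ? ? ?]; rewrite ?(tmk_bilin _ _).1 ?(tmk_bilin _ _).2. Qed.

Definition tswap V W : tens V W -> tens W V := tlift (fun v w => tmk w v).
HB.instance Definition _ V W :=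
  GRing.isLinear.Build K _ _ _ (@tswap V W) (tlift_linear (tswap_bilin V W)).

Fact tassoc_bilin1 V W X (x : X) : bilin (fun (v : V) (w : W) => tmk v (tmk w x)).
Proof. by split=> [? ? ? ?|? ? ? ?]; rewrite ?(tmk_bilin _ _).1 ?(tmk_bilin _ _).2. Qed.

Lemma tlift_param V W U X (b : X -> V -> W -> U) (t : tens V W) :
  (forall v w, linear (fun x => b x v w)) -> linear (fun x => tlift (b x) t).
Proof.
move=> hb a x y; rewrite /tlift /tsum scaler_sumr -big_split /=.
by apply: eq_bigr => p _; apply: hb.
Qed.

Fact tassoc_bilin V W X :
  bilin (fun (t : tens V W) (x : X) => tlift (fun v w => tmk v (tmk w x)) t).
Proof.
split=> [x|t]; first exact: (tlift_linear (tassoc_bilin1 V W x)).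
apply: tlift_param => v w a x y.
by rewrite (tmk_bilin W X).2 (tmk_bilin V (tens W X)).2.
Qed.

Definition tassoc V W X : tens (tens V W) X -> tens V (tens W X) :=
  tlift (fun t x => tlift (fun v w => tmk v (tmk w x)) t).
HB.instance Definition _ V W X :=
  GRing.isLinear.Build K _ _ _ (@tassoc V W X) (tlift_linear (@tassoc_bilin V W X)).

Lemma tmapE V W X Y (f : {linear V -> X}) (g : {linear W -> Y}) v w :
  tmap f g (tmk v w) = tmk (f v) (g w).
Proof. exact: (tlift_mk _ _ (tmap_bilin f g)). Qed.

Lemma tswapE V W (v : V) (w : W) : tswap (tmk v w) = tmk w v.
Proof. exact: (tlift_mk _ _ (tswap_bilin V W)). Qed.

Lemma tassocE V W X (v : V) (w : W) (x : X) :
  tassoc (tmk (tmk v w) x) = tmk v (tmk w x).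
Proof.
by rewrite /tassoc tlift_mk; [rewrite tlift_mk //; exact: tassoc_bilin1|exact: tassoc_bilin].
Qed.

End TensorMaps.

Arguments tlift : simpl never.
Arguments tlin : simpl never.
Arguments tmap : simpl never.
Arguments tswap : simpl never.
Arguments tassoc : simpl never.

(** * Coalgebras *)

Record coalgebra (K : fieldType) := Coalgebra {
  coalg_space :> lmodType K;
  comult : {linear coalg_space -> tens coalg_space coalg_space};
  counit : {linear coalg_space -> K^o};
  comultA : forall c,
    tassoc (tmap comult idfun (comult c)) = tmap idfun comult (comult c);
  counitl : forall c, tlift (fun a b => (counit a : K) *: b) (comult c) = c;
  counitr : forall c, tlift (fun a b => (counit b : K) *: a) (comult c) = c
}.

(** A right C-comodule is a left comodule over the opposite coalgebra.  Both kinds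
    of comodules are treated at once: a comodule on side [s] has a structure map
    [M -> C (x) M], coassociative for [comult_at s]; on the right side
    [m |-> \sum m_(1) (x) m_(0)] is the usual right coaction composed with the
    flip. *)
Variant side := lside | rside.

Definition opp_side s := if s is lside then rside else lside.

Section Comodules.
Variables (K : fieldType) (C : coalgebra K).

Definition comult_at (s : side) : {linear C -> tens C C} :=
  if s is lside then comult C else @tswap K C C \o comult C.

Record comodule (s : side) := Comodule {
  comod_space :> lmodType K;
  coact : {linear comod_space -> tens C comod_space};
  coactA : forall m,
    tassoc (tmap (comult_at s) idfun (coact m)) = tmap idfun coact (coact m);
  coact1 : forall m, tlift (fun c n => (counit C c : K) *: n) (coact m) = m
}.

Section Regular.

Fact trev_bilin1 (U V W : lmodType K) (u : U) : bilin (fun (v : V) (w : W) => tmk w (tmk v u)).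
Proof. by split=> [? ? ? ?|? ? ? ?]; rewrite ?(tmk_bilin _ _).1 ?(tmk_bilin _ _).2 ?(tmk_bilin _ _).1. Qed.

Fact trev_bilin (U V W : lmodType K) :
  bilin (fun (u : U) (t : tens V W) => tlin (trev_bilin1 V W u) t).
Proof.
split=> [t|u]; last by move=> a x y; rewrite linearP.
apply: tlift_param => v w a x y.
by rewrite (tmk_bilin V U).2 (tmk_bilin W (tens V U)).2.
Qed.

Definition trev (U V W : lmodType K) (t : tens U (tens V W)) : tens W (tens V U) :=
  tlin (@trev_bilin U V W) t.
HB.instance Definition _ U V W :=
  GRing.isLinear.Build K _ _ _ (@trev U V W) (tlift_linear (@trev_bilin U V W)).

Lemma trevE (U V W : lmodType K) (u : U) (v : V) (w : W) :
  trev (tmk u (tmk v w)) = tmk w (tmk v u).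
Proof. by rewrite /trev tlinE tlinE. Qed.

Let regular_assoc s (c : C) :
  tassoc (tmap (comult_at s) idfun (comult_at s c)) =
  tmap idfun (comult_at s) (comult_at s c).
Proof.
case: s => /=; first exact: comultA.
transitivity (trev (tmap idfun (comult C) (comult C c))).
  move: (comult C c) => t.
  pose f : {linear _ -> _} := @tassoc K C C C \o (tmap (@tswap K C C \o comult C) idfun \o @tswap K C C).
  pose g : {linear _ -> _} := @trev C C C \o tmap idfun (comult C).
  apply: (@tens_lin_eq _ _ _ _ f g) => a b; rewrite /f /g /= tswapE !tmapE /=.
  move: (comult C b) => u.
  have hb : linear (fun t : tens C C => tmk t a) by move=> ? ? ?; rewrite (tmk_bilin _ _).1.
  have hc : linear (fun t : tens C C => tmk a t) by move=> ? ? ?; rewrite (tmk_bilin _ _).2.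
  pose f' : {linear _ -> _} := @tassoc K C C C \o (to_linear hb \o @tswap K C C).
  pose g' : {linear _ -> _} := @trev C C C \o to_linear hc.
  apply: (@tens_lin_eq _ _ _ _ f' g') => x y; rewrite /f' /g' /= tswapE tassocE.
  by rewrite trevE.
rewrite -comultA.
move: (comult C c) => t.
pose f : {linear _ -> _} := @trev C C C \o (@tassoc K C C C \o tmap (comult C) idfun).
pose g : {linear _ -> _} := tmap idfun (@tswap K C C \o comult C) \o @tswap K C C.
apply: (@tens_lin_eq _ _ _ _ f g) => a b; rewrite /f /g /= tswapE !tmapE /=.
move: (comult C a) => u.
have hb : linear (fun t : tens C C => tmk t b) by move=> ? ? ?; rewrite (tmk_bilin _ _).1.
have hc : linear (fun t : tens C C => tmk b t) by move=> ? ? ?; rewrite (tmk_bilin _ _).2.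
pose f' : {linear _ -> _} := @trev C C C \o (@tassoc K C C C \o to_linear hb).
pose g' : {linear _ -> _} := to_linear hc \o @tswap K C C.
apply: (@tens_lin_eq _ _ _ _ f' g') => x y; rewrite /f' /g' /= tswapE tassocE.
by rewrite trevE.
Qed.

Let regular_counit s (c : C) :
  tlift (fun a b => (counit C a : K) *: b) (comult_at s c) = c.
Proof.
case: s => /=; first exact: counitl.
rewrite -[RHS]counitr; move: (comult C c) => t.
have hb : bilin (fun a b : C => (counit C a : K) *: b).
  split=> [w a x y|v a x y]; first by rewrite linearP scalerDl scalerA.
  by rewrite scalerDr !scalerA mulrC.
have hc : bilin (fun a b : C => (counit C b : K) *: a).
  split=> [w a x y|v a x y]; last by rewrite linearP scalerDl scalerA.
  by rewrite scalerDr !scalerA mulrC.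
pose f : {linear _ -> _} := tlin hb \o @tswap K C C.
apply: (@tens_lin_eq _ _ _ _ f (tlin hc)) => a b.
by rewrite /f /= tswapE !tlift_mk.
Qed.

Definition regular (s : side) : comodule s :=
  @Comodule s C (comult_at s) (regular_assoc s) (regular_counit s).

End Regular.
End Comodules.

(** * The category of comodules *)

Section ComoduleTheory.
Variables (K : fieldType) (C : coalgebra K) (s : side).
Implicit Types (L M N X Y E : comodule C s).

(** The second condition is [coact \o f = (id (x) f) \o coact], stated before [f] is
    known to be linear. *)
Fact comod_hom_subspace M N :
  subspace (fun f : M -> N => linear f /\
    forall m, coact N (f m) = tlift (fun c x => tmk c (f x)) (coact M m)).
Proof.
split=> [|a f g [hf cf] [hg cg]].
  split=> [a x y|m]; first by rewrite /= scaler0 addr0.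
  rewrite linear0 /tlift /tsum big1 // => p _.
  by have /= := (tmk_bilin C N).2 p.1 (-1) 0 0; rewrite scaler0 addr0 scaleN1r addNr.
have E x : (a *: f + g) x = a *: f x + g x by [].
split; first exact: ((linear_subspace M N).2 a f g hf hg).
move=> m; rewrite E linearP cf cg /tlift /tsum scaler_sumr -big_split /=.
by apply: eq_bigr => p _; rewrite (tmk_bilin C N).2.
Qed.

Definition HomC M N := sub_space (comod_hom_subspace M N).
HB.instance Definition _ M N := GRing.Lmodule.on (HomC M N).
Definition hom_fun M N (f : HomC M N) : M -> N := sub_val f.
Coercion hom_fun : HomC >-> Funclass.

Definition mono M N (f : HomC M N) := injective f.
Definition epi M N (f : HomC M N) := forall y, exists x, f x = y.
Definition exact L M N (f : HomC L M) (g : HomC M N) :=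
  forall y, g y = 0 <-> exists x, f x = y.

Definition zero_comod M := forall x : M, x = 0.

Definition isomorphic M N := exists f : HomC M N, mono f /\ epi f.

Definition subcomodule M (P : set M) :=
  subspace P /\ forall m, P m ->
    exists t : seq (C * M), (forall p, p \in t -> P p.2) /\
                            coact M m = \sum_(p <- t) tmk p.1 p.2.

Definition simple M := ~ zero_comod M /\
  forall P, subcomodule P -> P = [set 0 : M] \/ P = [set: M].

Definition simple_sub M (P : set M) := subcomodule P /\ P <> [set 0] /\
  forall Q, subcomodule Q -> Q `<=` P -> Q = [set 0] \/ Q = P.

Definition socle M : set M :=
  smallest (@subspace K M) (\bigcup_(P in @simple_sub M) P).

Definition indecomposable M := ~ zero_comod M /\
  forall P Q : set M, subcomodule P -> subcomodule Q ->
    (forall x, exists y z, P y /\ Q z /\ x = y + z) -> P `&` Q = [set 0] ->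
    P = [set 0] \/ Q = [set 0].

Definition essential M (P : set M) :=
  forall Q, subcomodule Q -> P `&` Q `<=` [set 0] -> Q `<=` [set 0].

Definition injective_comod E :=
  forall X Y (i : HomC X Y) (f : HomC X E), mono i ->
    exists g : HomC Y E, forall x, g (i x) = f x.

Definition projective_comod L :=
  forall X Y (p : HomC X Y) (f : HomC L Y), epi p ->
    exists g : HomC L X, forall x, p (g x) = f x.

Definition injective_envelope M E (u : HomC M E) :=
  [/\ mono u, injective_comod E & essential (range u)].

(** The [u i] are injective and [Z] is the internal direct sum of their images;
    [J] may be infinite. *)
Definition direct_sum (J : eqType) (F : J -> comodule C s) M
    (u : forall i, HomC (F i) M) (Z : set M) :=
  (forall x, Z x <-> exists (r : seq J) (y : forall i, F i), x = \sum_(i <- r) u i (y i)) /\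
  (forall (r : seq J) (y : forall i, F i), uniq r ->
     \sum_(i <- r) u i (y i) = 0 -> forall i, i \in r -> y i = 0).

End ComoduleTheory.

Section Dimension.
Variables (K : fieldType) (V : lmodType K).
Implicit Types B Z : set V.

(** [n] is the dimension of [Z / B], for [B] contained in [Z] *)
Definition has_qdim B Z (n : nat) :=
  exists x : 'I_n -> V, (forall i, Z (x i)) /\
    forall z, Z z -> exists! a : {ffun 'I_n -> K}, B (z - \sum_i a i *: x i).

Definition has_dim Z n := has_qdim [set 0] Z n.
Definition findim Z := exists n, has_dim Z n.

(** the dimension of a finite-dimensional subspace, and [0] otherwise *)
Definition dimK Z : nat := xget 0%N [set n | has_dim Z n].
End Dimension.

Section Resolutions.
Variables (K : fieldType) (C : coalgebra K) (s : side).
Implicit Types (M N X Y E S : comodule C s).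

Definition socle_finite M := findim (@socle K C s M).

Definition Cinj E := injective_comod E /\ socle_finite E.

Definition copresentation M E0 E1 (u : HomC M E0) (g : HomC E0 E1) :=
  mono u /\ exact u g.

Definition Comod_fc M := exists E0 E1 (u : HomC M E0) (g : HomC E0 E1),
  [/\ Cinj E0, Cinj E1 & copresentation u g].

Definition minimal_copresentation M E0 E1 (u : HomC M E0) (g : HomC E0 E1) :=
  [/\ Cinj E0, Cinj E1, copresentation u g, essential (range u) & essential (range g)].

Record injective_resolution M := InjRes {
  ir_term : nat -> comodule C s;
  ir_aug : HomC M (ir_term 0%N);
  ir_diff : forall m, HomC (ir_term m) (ir_term m.+1);
  ir_inj : forall m, injective_comod (ir_term m);
  ir_mono : mono ir_aug;
  ir_exact0 : exact ir_aug (ir_diff 0%N);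
  ir_exact : forall m, exact (ir_diff m) (ir_diff m.+1)
}.

Definition ir_length_le M (R : injective_resolution M) n :=
  forall m, (n < m)%N -> zero_comod (ir_term R m).

Definition ir_minimal M (R : injective_resolution M) :=
  essential (range (ir_aug R)) /\ forall m, essential (range (ir_diff R m)).

Definition inj_dim M n :=
  (exists R : injective_resolution M, ir_length_le R n) /\
  forall k, (exists R : injective_resolution M, ir_length_le R k) -> (n <= k)%N.

Definition cocycles M N (R : injective_resolution N) m : set (HomC M (ir_term R m)) :=
  [set h | forall x, ir_diff R m (h x) = 0].

Definition coboundaries M N (R : injective_resolution N) m : set (HomC M (ir_term R m)) :=
  match m with
  | 0 => [set 0]
  | m'.+1 => [set h | exists k : HomC M (ir_term R m'), forall x, h x = ir_diff R m' (k x)]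
  end.

(** [dim Ext^m (M, N) = n] *)
Definition has_dim_Ext m M N n := exists R : injective_resolution N,
  has_qdim (@coboundaries M N R m) (@cocycles M N R m) n.

End Resolutions.

(** * The convolution algebra and pseudocompact modules *)

Section Convolution.
Variables (K : fieldType) (C : coalgebra K).

Notation Cstar := (dual C).

Fact conv_bilin (f g : Cstar) : bilin (fun a b : C => f a * g b : K^o).
Proof.
split=> [w a x y|v a x y]; rewrite dual_linear /=.
- by rewrite mulrDl /GRing.scale /= mulrA.
- by rewrite mulrDr /GRing.scale /= mulrCA.
Qed.

Fact conv_linear s (f g : Cstar) :
  linear (fun c => tlift (fun a b => f a * g b : K^o) (comult_at C s c) : K^o).
Proof. by move=> a x y; rewrite linearP tlift_linear //; exact: conv_bilin. Qed.

(** the product of [C^*] for [s = lside], and the opposite product for [s = rside] *)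
Definition conv s (f g : Cstar) : Cstar := in_sub _ (conv_linear s f g).

Fact counit_linear : linear (counit C : C -> K^o).
Proof. exact: linearP. Qed.

Definition conv1 : Cstar := in_sub _ counit_linear.

Lemma conv_opp s (f g : Cstar) : conv (opp_side s) f g = conv s g f.
Proof.
have E : forall (f g : Cstar) (t : tens C C), tlift (fun a b => f a * g b : K^o) (tswap t) =
                 tlift (fun a b => g a * f b : K^o) t.
  move=> {}f {}g t.
  apply: (@tens_lin_ext _ _ _ _ (fun t => tlift _ (tswap t)) (tlift _)).
  - by move=> a x y; rewrite linearP tlift_linear //; exact: conv_bilin.
  - exact: tlift_linear (conv_bilin _ _).
  move=> a b; rewrite tswapE [LHS](tlift_mk _ _ (conv_bilin f g)).
  by rewrite [RHS](tlift_mk _ _ (conv_bilin g f)) mulrC.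
apply: dual_ext => c; rewrite /dual_fun /=; case: s => /=; first exact: E.
by symmetry; exact: E.
Qed.

(** A comodule on side [s] is a module on the other side over the convolution
    algebra: [m . f = \sum f (m_(-1)) m_(0)] on the left, [f . m = \sum f (m_(1)) m_(0)]
    on the right. *)
Section Action.
Variables (s : side) (M : comodule C s).

Definition act (f : Cstar) (m : M) : M := tlift (fun c n => f c *: n) (coact M m).

Fact act_bilin1 (f : Cstar) : bilin (fun (c : C) (n : M) => f c *: n).
Proof.
split=> [w a x y|v a x y]; first by rewrite dual_linear scalerDl scalerA.
by rewrite scalerDr !scalerA mulrC.
Qed.

Lemma act_bilin : bilin act.
Proof.
split=> [m|f a x y]; last by rewrite /act linearP (tlift_linear (act_bilin1 f)).
apply: tlift_param => c n a f g.
by rewrite dual_addE scalerDl scalerA.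
Qed.

Lemma act_linear f : linear (act f).
Proof. exact: act_bilin.2. Qed.

Lemma act1 m : act conv1 m = m.
Proof. exact: coact1. Qed.

Lemma actM f g m : act (conv s f g) m = act g (act f m).
Proof.
have h1 (c : C) : bilin (fun (d : C) (n : M) => (f c * g d) *: n).
  split=> [w a x y|v a x y]; rewrite ?dual_linear.
    by rewrite mulrDr scalerDl scalerA /GRing.scale /= mulrCA.
  by rewrite scalerDr !scalerA mulrC.
have h2 : bilin (fun (c : C) (t : tens C M) => tlift (fun d n => (f c * g d) *: n) t).
  split=> [t|c]; last exact: tlift_linear.
  apply: tlift_param => d n a x y.
  by rewrite dual_linear mulrDl scalerDl scalerA /GRing.scale /= mulrA.
pose Psi : tens C (tens C M) -> M :=
  tlift (fun c => tlift (fun d n => (f c * g d) *: n)).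
have lPsi : linear Psi := tlift_linear h2.
transitivity (Psi (tassoc (tmap (comult_at C s) idfun (coact M m)))).
  rewrite {1}/act; move: (coact M m) => t.
  pose F := to_linear (tlift_linear (act_bilin1 (conv s f g))).
  pose G : {linear _ -> _} := to_linear lPsi \o
    (@tassoc K C C M \o tmap (comult_at C s) idfun).
  apply: (@tens_lin_eq _ _ _ _ F G) => c n.
  rewrite /F /G /= (tlift_mk _ _ (act_bilin1 (conv s f g))).
  rewrite tmapE {1}/conv /dual_fun /=; move: (comult_at C s c) => u.
  have k1 : linear (fun u : tens C C => tlift (fun a b => f a * g b : K^o) u *: n).
    by move=> a x y; rewrite (tlift_linear (conv_bilin f g)) scalerDl scalerA.
  have k2 : linear (fun u : tens C C => Psi (tassoc (tmk u n))).
    by move=> a x y; rewrite (tmk_bilin _ _).1 linearP lPsi.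
  apply: (tens_lin_ext k1 k2) => a b.
  rewrite (tlift_mk _ _ (conv_bilin f g)).
  by rewrite tassocE /Psi tlift_mk // tlift_mk.
rewrite coactA /act; move: (coact M m) => t.
have l : linear (fun t : tens C M => act g (tlift (fun c n => f c *: n) t)).
  by move=> a x y; rewrite (tlift_linear (act_bilin1 f)) act_linear.
pose G : {linear _ -> _} := to_linear lPsi \o tmap idfun (coact M).
apply: (@tens_lin_eq _ _ _ _ G (to_linear l)) => c n.
rewrite /G /= tmapE /Psi (tlift_mk _ _ h2) (tlift_mk _ _ (act_bilin1 f)) /=.
rewrite /act linearZ /=.
have e : forall u : tens C M, tlift (fun d x => (f c * g d) *: x) u =
   f c *: tlift (fun d x => g d *: x) u.
  by move=> u; rewrite /tlift /tsum scaler_sumr; apply: eq_bigr => p _; rewrite scalerA.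
rewrite e; symmetry; exact: (linearZ_LR (tlin (act_bilin1 g))).
Qed.

End Action.

Lemma act_hom s (M N : comodule C s) (h : HomC M N) f m : act f (h m) = h (act f m).
Proof.
have /asboolP [lh ch] := sub_valP h.
pose h' := to_linear lh.
rewrite /act [coact N (h m)]ch; move: (coact M m) => t.
have l1 : linear (fun t : tens C M => tlift (fun c n => f c *: n) (tmap idfun h' t)).
  by move=> a x y; rewrite linearP (tlift_linear (act_bilin1 N f)).
have l2 : linear (fun t : tens C M => h' (tlift (fun c n => f c *: n) t)).
  by move=> a x y; rewrite (tlift_linear (act_bilin1 M f)) linearP.
apply: (tens_lin_ext l1 l2) => c n.
rewrite tmapE (tlift_mk _ _ (act_bilin1 N f)) (tlift_mk _ _ (act_bilin1 M f)).
by rewrite linearZ_LR.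
Qed.

(** the two actions of [C^*] on [C] commute *)
Lemma act_regularC s f g (c : C) :
  @act s (regular C s) f (@act (opp_side s) (regular C (opp_side s)) g c) =
  @act (opp_side s) (regular C (opp_side s)) g (@act s (regular C s) f c).
Proof.
suff h f' g' : @act lside (regular C lside) f' (@act rside (regular C rside) g' c) =
    @act rside (regular C rside) g' (@act lside (regular C lside) f' c).
  by case: s => /=; rewrite h.
have h1 (x : C) : bilin (fun (d e : C) => (f' x * g' e) *: d).
  split=> [w a y z|v a y z]; rewrite ?dual_linear.
    by rewrite scalerDr !scalerA mulrC.
  by rewrite mulrDr scalerDl scalerA /GRing.scale /= mulrCA.
have h2 : bilin (fun (x : C) (t : tens C C) => tlift (fun d e => (f' x * g' e) *: d) t).
  split=> [t|x]; last exact: tlift_linear.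
  apply: tlift_param => d e a y z.
  by rewrite dual_linear mulrDl scalerDl scalerA /GRing.scale /= mulrA.
pose Psi : tens C (tens C C) -> C :=
  tlift (fun x => tlift (fun d e => (f' x * g' e) *: d)).
have lPsi : linear Psi := tlift_linear h2.
have bL (f0 : Cstar) := act_bilin1 (regular C lside) f0.
have actRE (x : C) : @act rside (regular C rside) g' x =
    tlift (fun d e => g' e *: d) (comult C x).
  rewrite /act /=; move: (comult C x) => t.
  have b2 : bilin (fun d e : C => g' e *: d).
    by split=> [w a y z|v a y z]; [exact: (bL g').2|exact: (bL g').1].
  have k1 : linear (fun t : tens C C => tlift (fun d e => g' d *: e) (tswap t)).
    by move=> a y z; rewrite linearP (tlift_linear (bL g')).
  apply: (tens_lin_ext k1 (tlift_linear b2)) => y z.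
  by rewrite tswapE (tlift_mk _ _ (bL g')) (tlift_mk _ _ b2).
have b2 : bilin (fun d e : C => g' e *: d).
  by split=> [w a y z|v a y z]; [exact: (bL g').2|exact: (bL g').1].
transitivity (Psi (tassoc (tmap (comult C) idfun (comult C c)))).
  rewrite actRE; move: (comult C c) => t.
  have k1 : linear (fun t : tens C C => @act lside (regular C lside) f'
      (tlift (fun d e => g' e *: d) t)).
    by move=> a y z; rewrite (tlift_linear b2) act_linear.
  have k2 : linear (fun t => Psi (tassoc (tmap (comult C) idfun t))).
    by move=> a y z; rewrite linearP linearP lPsi.
  apply: (tens_lin_ext k1 k2) => y z; rewrite (tlift_mk _ _ b2) tmapE /=.
  have -> : @act lside (regular C lside) f' (g' z *: y) =
            g' z *: @act lside (regular C lside) f' y.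
    exact: (linearZ_LR (to_linear (@act_linear lside (regular C lside) f'))).
  rewrite /act /=; move: (comult C y) => u.
  have k3 : linear (fun u : tens C C => g' z *: tlift (fun c n => f' c *: n) u).
    move=> a v w; rewrite (tlift_linear (bL f')) scalerDr !scalerA.
    by rewrite [a * _]mulrC.
  have k4 : linear (fun u : tens C C => Psi (tassoc (tmk u z))).
    by move=> a v w; rewrite (tmk_bilin _ _).1 linearP lPsi.
  apply: (tens_lin_ext k3 k4) => v w.
  rewrite (tlift_mk _ _ (bL f')).
  by rewrite tassocE /Psi tlift_mk // tlift_mk // scalerA mulrC.
rewrite comultA {2}/act /=; move: (comult C c) => t.
have k1 : linear (fun t => Psi (tmap idfun (comult C) t)).
  by move=> a y z; rewrite linearP lPsi.
have k2 : linear (fun t => @act rside (regular C rside) g' (tlift (fun c n => f' c *: n) t)).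
  by move=> a y z; rewrite (tlift_linear (bL f')) act_linear.
apply: (tens_lin_ext k1 k2) => y z.
rewrite tmapE /= (tlift_mk _ _ (bL f')).
rewrite /Psi tlift_mk //.
have -> : @act rside (regular C rside) g' (f' y *: z) =
          f' y *: @act rside (regular C rside) g' z.
  exact: (linearZ_LR (to_linear (@act_linear rside (regular C rside) g'))).
rewrite actRE /tlift /tsum scaler_sumr; apply: eq_bigr => p _.
by rewrite scalerA.
Qed.

End Convolution.

Section TopologicalModules.
Variables (K : fieldType) (C : coalgebra K).

(** Linearly topologised modules over [C^*]: right modules for [s = lside] and left
    modules for [s = rside].  The topology is given by a basis of neighbourhoods of
    [0] consisting of [K]-subspaces. *)
Record tmodule (s : side) := TModule {
  tm_space :> lmodType K;
  tm_act : dual C -> tm_space -> tm_space;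
  tm_act_bilin : bilin tm_act;
  tm_act1 : forall y, tm_act (conv1 C) y = y;
  tm_actM : forall f g y, tm_act (conv s f g) y = tm_act g (tm_act f y);
  tm_nbhd : set (set tm_space);
  tm_nbhd_sub : forall U, tm_nbhd U -> subspace U;
  tm_nbhd_ex : exists U, tm_nbhd U;
  tm_nbhdI : forall U W, tm_nbhd U -> tm_nbhd W ->
    exists U', tm_nbhd U' /\ U' `<=` U `&` W
}.

Section Morphisms.
Variables (s : side) (X Y : tmodule s).

Definition tcontinuous (h : X -> Y) :=
  forall U, tm_nbhd U -> exists W, tm_nbhd W /\ forall x : X, W x -> U (h x).

Fact chom_subspace : subspace (fun h : X -> Y =>
  [/\ linear h, forall f x, h (tm_act f x) = tm_act f (h x) & tcontinuous h]).
Proof.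
have aZ f a x y : tm_act f (a *: x + y : Y) = a *: tm_act f x + tm_act f y.
  exact: (tm_act_bilin Y).2.
split.
  split=> [a x y|f x|U hU]; first by rewrite /= scaler0 addr0.
    have := aZ f (-1) 0 0; rewrite scaler0 addr0 scaleN1r addNr.
    by move=> e; symmetry.
  have [W hW] := tm_nbhd_ex X; exists W; split=> // x _.
  exact: (tm_nbhd_sub hU).1.
move=> a g h [lg eg cg] [lh eh ch]; split.
- exact: ((linear_subspace X Y).2 a g h lg lh).
- by move=> f x; rewrite -[RHS]/(tm_act f (a *: g x + h x)) aZ -eg -eh.
move=> U hU; have [W1 [hW1 k1]] := cg U hU; have [W2 [hW2 k2]] := ch U hU.
have [W [hW k]] := tm_nbhdI hW1 hW2; exists W; split=> // x /k[x1 x2].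
by apply: (tm_nbhd_sub hU).2; [exact: k1|exact: k2].
Qed.

Definition chom := sub_space chom_subspace.
HB.instance Definition _ := GRing.Lmodule.on chom.
Definition chom_fun (h : chom) : X -> Y := sub_val h.

Definition tepi (h : chom) := forall y, exists x, chom_fun h x = y.

End Morphisms.
Coercion chom_fun : chom >-> Funclass.

Section Pseudocompact.
Variable s : side.
Implicit Types (P Q A B Y : tmodule s).

Definition submodule Y (U : set Y) :=
  subspace U /\ forall f y, U y -> U (tm_act f y).

Definition open_submodule Y (U : set Y) :=
  submodule U /\ exists W, tm_nbhd W /\ W `<=` U.

(** neighbourhoods of [0] in [C^*] are given by finite subsets of [C] *)
Definition pseudocompact Y :=
  [/\ forall U : set Y, tm_nbhd U -> exists W,
        [/\ open_submodule W, W `<=` U & exists n, has_qdim W [set: Y] n],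
      forall y : Y, (forall U, tm_nbhd U -> U y) -> y = 0,
      forall z : set Y -> Y,
        (forall U W, tm_nbhd U -> tm_nbhd W -> W `<=` U -> U (z W - z U)) ->
        exists y, forall U, tm_nbhd U -> U (y - z U) &
      forall (f : dual C) (y : Y) U, tm_nbhd U -> exists (r : seq C) W,
        tm_nbhd W /\ forall (g : dual C) w, (forall c, c \in r -> g c = 0) -> W w ->
          U (tm_act (f + g) (y + w) - tm_act f y)].

Definition projective_PC P := pseudocompact P /\
  forall A B (q : chom A B) (f : chom P B), pseudocompact A -> pseudocompact B ->
    tepi q -> exists g : chom P A, forall x, q (g x) = f x.

Definition maximal_open_submodule Y (U : set Y) := open_submodule U /\
  U <> [set: Y] /\ forall W, submodule W -> U `<=` W -> W = U \/ W = [set: Y].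

Definition radical Y : set Y :=
  [set y | forall U, maximal_open_submodule U -> U y].

Definition top_finite Y := exists n, has_qdim (@radical Y) [set: Y] n.

End Pseudocompact.

Section ComoduleModules.
Variables (s : side).
Implicit Types M N : comodule C s.

(** a comodule as a discrete rational [C^*]-module *)
Definition rational M : tmodule s.
Proof.
apply: (@TModule s M (@act _ _ s M) (@act_bilin _ _ s M) (@act1 _ _ s M)
  (@actM _ _ s M) [set [set 0]]).
- move=> U /= ->; split=> // a x y /= -> ->; by rewrite scaler0 addr0.
- by exists [set 0].
- by move=> U W /= -> ->; exists [set 0]; split=> // x ->.
Defined.

Fact dual_act_linear M (f : dual C) (phi : dual M) :
  linear (fun m : M => phi (act f m) : K^o).
Proof. by move=> a x y; rewrite act_linear dual_linear. Qed.

Definition dual_act M (f : dual C) (phi : dual M) : dual M :=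
  in_sub _ (dual_act_linear f phi).

(** [M^*], with the topology of pointwise convergence *)
Definition dualmod M : tmodule (opp_side s).
Proof.
apply: (@TModule (opp_side s) (dual M) (@dual_act M) _ _ _
  [set U | exists r : seq M, U = [set phi | forall m, m \in r -> dual_fun phi m = 0]]).
- split=> [phi a f g|f a phi psi]; apply: dual_ext => m; last by [].
  rewrite dual_addE -[LHS]/(dual_fun phi (act (a *: f + g) m)) (act_bilin M).1.
  by rewrite dual_linear.
- by move=> phi; apply: dual_ext => m; rewrite -[LHS]/(dual_fun phi (act _ m)) act1.
- move=> f g phi; apply: dual_ext => m.
  by rewrite -[LHS]/(dual_fun phi (act _ m)) conv_opp actM.
- move=> _ [r ->]; split=> [m _ //|a phi psi h1 h2 m hm].
  by rewrite dual_addE h1 // h2 // mulr0 addr0.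
- by exists [set phi | forall m, m \in [::] -> dual_fun phi m = 0], [::].
- move=> _ _ [r ->] [t ->].
  exists [set phi | forall m, m \in r ++ t -> dual_fun phi m = 0].
  split; first by exists (r ++ t).
  by move=> phi h; split=> m hm; apply: h; rewrite mem_cat hm ?orbT.
Defined.

End ComoduleModules.

(** [C^*] as a module over itself, a left one for [s = lside] and a right one for
    [s = rside] *)
Definition Cstar_mod s : tmodule (opp_side s) := dualmod (regular C s).

Section Nabla.
Variables (s : side).
Implicit Types M N : comodule C s.

(** [hom (M^*, C^* )], the continuous [C^*]-homomorphisms *)
Definition hstar M := chom (dualmod M) (Cstar_mod s).
HB.instance Definition _ M := GRing.Lmodule.on (hstar M).
Definition hstar_fun M (h : hstar M) : dual M -> dual C := sub_val h.
Coercion hstar_fun : hstar >-> Funclass.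

(** [K]-linear forms on [hstar M] continuous for the topology of uniform convergence;
    for socle-finite [M] this topology is pseudocompact. *)
Definition hstar_continuous M (xi : dual (hstar M)) :=
  exists r : seq C, forall h : hstar M,
    (forall (phi : dual M) c, c \in r -> h phi c = 0) -> xi h = 0.

(** [hom (M^*, C^* )] is a module on the other side, through the values in [C^*]. *)
Fact hstar_act_proof M (f : dual C) (h : hstar M) :
  let k := fun phi : dualmod M =>
    dual_act (s := opp_side s) (M := regular C (opp_side s)) f (h phi) : Cstar_mod s in
  [/\ linear k, forall g phi, k (tm_act g phi) = tm_act g (k phi) & tcontinuous k].
Proof.
have /asboolP [lh eh ch] := sub_valP h.
split.
- by move=> a x y; rewrite /hstar_fun lh; apply: dual_ext.
- move=> g phi; rewrite /hstar_fun eh; apply: dual_ext => c.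
  rewrite -[LHS]/(dual_fun (sub_val h phi : dual C)
     (@act _ _ s (regular C s) g (@act _ _ _ (regular C (opp_side s)) f c))).
  by rewrite act_regularC.
move=> _ [r ->].
pose r' : seq C := [seq @act _ _ _ (regular C (opp_side s)) f c | c <- r].
have [|W [hW k]] := ch [set phi | forall m, m \in r' -> dual_fun phi m = 0].
  by exists r'.
exists W; split=> // phi /k hphi c hc; apply: hphi.
by rewrite /r'; apply/mapP; exists c.
Qed.

Definition hstar_act M (f : dual C) (h : hstar M) : hstar M :=
  in_sub _ (hstar_act_proof f h).

Fact hstar_map_subproof M N (g : HomC M N) (psi : dual N) :
  linear (fun m : M => psi (g m) : K^o).
Proof.
by have /asboolP [lg _] := sub_valP g => a x y; rewrite /hom_fun lg dual_linear.
Qed.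

Definition dual_map M N (g : HomC M N) (psi : dual N) : dual M :=
  in_sub _ (hstar_map_subproof g psi).

Fact hstar_map_proof M N (g : HomC M N) (h : hstar M) :
  let k := fun psi : dualmod N => h (dual_map g psi) : Cstar_mod s in
  [/\ linear k, forall f psi, k (tm_act f psi) = tm_act f (k psi) & tcontinuous k].
Proof.
have /asboolP [lh eh ch] := sub_valP h.
split.
- move=> a x y /=; rewrite -[RHS]lh; congr (sub_val h _); exact: dual_ext.
- move=> f psi /=; rewrite -[RHS]eh; congr (sub_val h _); apply: dual_ext => m.
  rewrite -[LHS]/(dual_fun psi (act f (g m))) -[RHS]/(dual_fun psi (g (act f m))).
  by rewrite act_hom.
move=> U hU; have [_ [[r ->] k]] := ch U hU.
exists [set psi | forall m, m \in [seq g x | x <- r] -> dual_fun psi m = 0].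
split; first by exists [seq g x | x <- r].
by move=> psi hpsi; apply: k => m hm; apply: hpsi; apply/mapP; exists m.
Qed.

(** [h |-> h \o g^*] *)
Definition hstar_map M N (g : HomC M N) (h : hstar M) : hstar N :=
  in_sub _ (hstar_map_proof g h).

(** [th] identifies the comodule [N] with [nabla M], the space of continuous linear
    forms on [hstar M].  A comodule is determined by its [C^*]-module structure. *)
Definition is_nabla M (N : comodule C (opp_side s)) (th : N -> dual (hstar M)) :=
  [/\ linear th,
      injective th,
      forall xi, hstar_continuous xi <-> exists x, th x = xi &
      forall f x h, th (act f x) h = th x (hstar_act f h)].

(** [ng] is [nabla g], in terms of such identifications *)
Definition is_nabla_map M M' (N N' : comodule C (opp_side s))
    (th : N -> dual (hstar M)) (th' : N' -> dual (hstar M'))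
    (g : HomC M M') (ng : HomC N' N) :=
  forall x h, th (ng x) h = th' x (hstar_map g h).

(** [T] is isomorphic to the transpose [Tr M] *)
Definition is_Tr M (T : comodule C (opp_side s)) :=
  exists (E0 E1 : comodule C s) (u : HomC M E0) (g : HomC E0 E1)
         (N0 N1 : comodule C (opp_side s))
         (th0 : N0 -> dual (hstar E0)) (th1 : N1 -> dual (hstar E1))
         (ng : HomC N1 N0) (k : HomC T N1),
    [/\ minimal_copresentation u g, is_nabla th0, is_nabla th1,
        is_nabla_map th0 th1 g ng & mono k /\ exact k ng].

(** [X] is isomorphic to the dual comodule [D N] of the finite-dimensional [N] *)
Definition is_D (N : comodule C s) (X : comodule C (opp_side s)) :=
  findim [set: N] /\ exists th : X -> dual N,
    [/\ linear th, injective th, forall phi, exists x, th x = phi &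
        forall f x, th (act f x) = dual_act f (th x)].

Definition Comod_fc_bullet M :=
  Comod_fc M /\ exists T, is_Tr M T /\ findim [set: T].

(** [N] has a minimal presentation [P1 -> P0 -> N -> 0] by top-finite projective
    pseudocompact modules *)
Definition comod_fP N := findim [set: N] /\
  exists (P0 P1 : tmodule s) (p0 : chom P0 (rational N)) (p1 : chom P1 P0),
    [/\ projective_PC P0 /\ top_finite P0, projective_PC P1 /\ top_finite P1,
        tepi p0 /\ (forall y : P0, p0 y = 0 <-> exists x, p1 x = y),
        forall Q (h : chom Q P0), pseudocompact Q ->
          (forall n, exists z, p0 (h z) = n) -> tepi h &
        forall Q (h : chom Q P1), pseudocompact Q ->
          (forall x, exists z, p1 (h z) = p1 x) -> tepi h].

End Nabla.
End TopologicalModules.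

(** * Almost split sequences *)

Section AlmostSplit.
Variables (K : fieldType) (C : coalgebra K) (s : side).
Implicit Types M N X Y B : comodule C s.

Variable A : comodule C s -> Prop.

Definition split_mono M N (f : HomC M N) := exists r : HomC N M, forall x, r (f x) = x.
Definition split_epi M N (f : HomC M N) := exists r : HomC N M, forall y, f (r y) = y.

(** almost split sequences in the full subcategory given by [A] *)
Definition almost_split M B N (f : HomC M B) (g : HomC B N) :=
  [/\ A M /\ A B /\ A N,
      mono f /\ exact f g /\ epi g,
      ~ split_mono f /\ ~ split_epi g,
      forall Y (u : HomC M Y), A Y -> ~ split_mono u ->
        exists v : HomC B Y, forall x, v (f x) = u x &
      forall Y (u : HomC Y N), A Y -> ~ split_epi u ->
        exists v : HomC Y B, forall x, g (v x) = u x].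

Definition unique_almost_split_from M B N (f : HomC M B) (g : HomC B N) :=
  almost_split f g /\
  forall B' N' (f' : HomC M B') (g' : HomC B' N'), almost_split f' g' ->
    exists (b : HomC B B') (n : HomC N N'),
      [/\ mono b /\ epi b, mono n /\ epi n,
          forall x, b (f x) = f' x & forall x, g' (b x) = n (g x)].

Definition unique_almost_split_to M B N (f : HomC M B) (g : HomC B N) :=
  almost_split f g /\
  forall M' B' (f' : HomC M' B') (g' : HomC B' N), almost_split f' g' ->
    exists (m : HomC M M') (b : HomC B B'),
      [/\ mono m /\ epi m, mono b /\ epi b,
          forall x, b (f x) = f' (m x) & forall x, g' (b x) = g x].

End AlmostSplit.

(** * Pointed sharp Euler coalgebras *)

Section Euler.
Variables (K : fieldType) (C : coalgebra K).

Definition pointed :=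
  forall s (S : comodule C s), simple S -> has_dim [set: S] 1.

Definition computable := forall E E' : comodule C lside,
  injective_comod E -> indecomposable E -> injective_comod E' -> indecomposable E' ->
  findim [set: HomC E E'].

Definition sharp_Euler_at s := computable /\
  forall S : comodule C s, simple S -> exists R : injective_resolution S,
    (exists n, ir_length_le R n) /\ forall m, socle_finite (ir_term R m).

Definition sharp_Euler :=
  [/\ sharp_Euler_at lside, sharp_Euler_at rside &
      forall (S S' : comodule C lside) (DS DS' : comodule C rside) m n,
        simple S -> simple S' -> is_D S DS -> is_D S' DS' ->
        has_dim_Ext m S S' n <-> has_dim_Ext m DS' DS n].

Definition primitive_idempotent (e : dual C) :=
  [/\ conv lside e e = e, e <> 0 &
      forall f g : dual C, conv lside f f = f -> conv lside g g = g ->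
        conv lside f g = 0 -> conv lside g f = 0 -> e = f + g -> f = 0 \/ g = 0].

(** [e . c] and [c . e] *)
Definition lmulC (e : dual C) (c : C) : C := @act _ _ rside (regular C rside) e c.
Definition rmulC (c : C) (e : dual C) : C := @act _ _ lside (regular C lside) e c.

(** A decomposition of the socle of the left comodule [C] into simple comodules [S j],
    with the injective envelopes [E j], the right comodules [Shat j = D (S j)] and
    [Ehat j = nabla (E j)], and idempotents [e j] such that [E j] is isomorphic to
    [e_j C] and [Ehat j] to [C e_j]. *)
Record socle_data (I : choiceType) := SocleData {
  sd_S : I -> comodule C lside;
  sd_emb : forall j, HomC (sd_S j) (regular C lside);
  sd_simple : forall j, simple (sd_S j);
  sd_socle : direct_sum sd_emb (@socle _ _ _ (regular C lside));
  sd_repr : forall T : comodule C lside, simple T -> exists! j, isomorphic T (sd_S j);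
  sd_E : I -> comodule C lside;
  sd_env : forall j, HomC (sd_S j) (sd_E j);
  sd_envP : forall j, injective_envelope (sd_env j);
  sd_Shat : I -> comodule C rside;
  sd_D : forall j, is_D (s := lside) (sd_S j) (sd_Shat j);
  sd_Ehat : I -> comodule C rside;
  sd_nabla : forall j, sd_Ehat j -> dual (hstar (sd_E j));
  sd_nablaP : forall j, is_nabla (s := lside) (@sd_nabla j);
  sd_envhat : forall j, HomC (sd_Shat j) (sd_Ehat j);
  sd_envhatP : forall j, injective_envelope (sd_envhat j);
  sd_e : I -> dual C;
  sd_prim : forall j, primitive_idempotent (sd_e j);
  sd_eC : forall j, exists u : HomC (sd_E j) (regular C lside),
    mono u /\ range u = range (lmulC (sd_e j));
  sd_Ce : forall j, exists u : HomC (sd_Ehat j) (regular C rside),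
    mono u /\ range u = range (rmulC^~ (sd_e j))
}.

Section Vectors.
Variables (I : choiceType) (d : socle_data I).

(** [dim (M e_j)] *)
Definition dimvec (M : comodule C lside) : I -> int :=
  fun j => (dimK (range (act (sd_e d j) : M -> M)))%:Z.

Definition dimvec_right (X : comodule C rside) : I -> int :=
  fun j => (dimK [set: HomC X (sd_Ehat d j)])%:Z.

(** [dim (e_i C e_j)] *)
Definition cartan (i j : I) : int :=
  (dimK (range (fun c => rmulC (lmulC (sd_e d i) c) (sd_e d j))))%:Z.

(** row vector times matrix; [\sum_(i \in _)] is [0] when infinitely many terms are
    nonzero *)
Definition vmul (x : I -> int) (A : I -> I -> int) : I -> int :=
  fun j => \sum_(i \in [set: I]) x i * A i j.

Definition mtr (A : I -> I -> int) : I -> I -> int := fun i j => A j i.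

(** [X] is isomorphic to the direct sum of the [E j], for [j] in [ks] *)
Definition inj_decomposition (X : comodule C lside) (ks : seq I) :=
  exists u : forall p : 'I_(size ks), HomC (sd_E d (tnth (in_tuple ks) p)) X,
    direct_sum u [set: X].

(** the row-finite and column-finite two-sided inverse of the Cartan matrix; its
    entries are the alternating sums of the multiplicities of the [E j] in minimal
    injective resolutions of the [S i] *)
Definition is_cartan_inverse (A : I -> I -> int) :=
  [/\ forall i, finite_set [set j | A i j != 0],
      forall j, finite_set [set i | A i j != 0],
      forall i j, vmul (cartan i) A j = (i == j)%:Z,
      forall i j, vmul (A i) cartan j = (i == j)%:Z &
      forall i, exists (R : injective_resolution (sd_S d i)) (n : nat) (ks : nat -> seq I),
        [/\ ir_minimal R, ir_length_le R n,
            forall m, inj_decomposition (ir_term R m) (ks m) &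
            forall j, A i j = \sum_(m < n.+1) (-1) ^+ m * (count_mem j (ks m))%:Z]].

Definition is_subgroup (G : set (I -> int)) :=
  G 0 /\ forall x y, G x -> G y -> G (x - y).

Definition Z_right : set (I -> int) :=
  smallest is_subgroup (range (fun a => dimvec_right (sd_Ehat d a))).
Definition Z_left : set (I -> int) :=
  smallest is_subgroup (range (fun a => dimvec (sd_E d a))).

Variable cinv : I -> I -> int.

(** The Coxeter transformations, whose domains are [Z_right] and [Z_left]
    respectively; elsewhere the sums in [vmul] may be meaningless. *)
Definition Phi (x : I -> int) : I -> int := - vmul (vmul x (mtr cinv)) cartan.
Definition Phi_minus (y : I -> int) : I -> int := - vmul (vmul y cinv) (mtr cartan).

End Vectors.

(** [X] is isomorphic to [tau^- M = D (Tr M)] *)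
Definition is_tau_minus (M X : comodule C lside) :=
  exists T : comodule C rside, is_Tr (s := lside) M T /\ is_D (s := rside) T X.

(** [DN] is isomorphic to [D N] and [X] to [tau N = Tr (D N)] *)
Definition is_tau (N : comodule C lside) (DN : comodule C rside) (X : comodule C lside) :=
  is_D (s := lside) N DN /\ is_Tr (s := rside) DN X.

End Euler.

(* Main.v *)
(* Write 0 -> M -> E0 -> E1 for the minimal copresentation. As inj.dim M = 1, the map
   E0 -> E1 is onto, so dim M = dim E0 - dim E1 where E0 and E1 are finite direct sums
   of the E(j). The space e_j Tr M is the annihilator of the image of Hom (E(j), E0) in
   the dual of Hom (E(j), E1), and Hom (E(j), E0) -> Hom (E(j), E1) is injective because
   Hom (C, M) = 0; hence dim e_j Tr M = dim Hom (E(j), E1) - dim Hom (E(j), E0). Finally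
   dim Hom (E(j), E(i)) = dim e_j C e_i, so on dimension vectors M |-> Tr M exchanges the
   rows and the columns of the Cartan matrix up to sign, which is what the Coxeter
   transformations do. Both parts of the theorem are this argument, on either side. *)

From HB Require Import structures.
Require Import Defs.
From mathcomp Require Import all_boot all_algebra.
From mathcomp Require Import boolp classical_sets functions cardinality fsbigop.

Set Implicit Arguments.
Unset Strict Implicit.
Unset Printing Implicit Defensive.

Import GRing.Theory.
Local Open Scope classical_set_scope.
Local Open Scope ring_scope.

(** * Linear forms and tensors *)

(** The spaces may be infinite-dimensional, so no dual basis is at hand. Two devices replace it. A
    tensor whose contractions by all linear forms vanish is zero, so coassociativity, stability
    under the coaction and compatibility with it can all be tested on the action of the convolution
    algebra. Every passage between a space and a dual one is a bilinear pairing without kernel on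
    either side, which carries finiteness along with the dimension. The argument is run once, over
    an [injective_basis] on an arbitrary side. On the left the data supply such a basis directly; on
    the right it has to be shown that the comodules D S(j) are simple and exhaust the simple right
    comodules, and this is where pointedness enters. Finiteness of the Cartan entries comes from
    computability. Dimension vectors may have infinite support, so matrix products are not
    manipulated freely: the Coxeter transformations are evaluated only on finite integer
    combinations of rows or columns of the Cartan matrix. *)

Section LinearAlgebra.
Variable K : fieldType.
Implicit Types U V W : lmodType K.

Section Subspaces.
Variables (V : lmodType K) (P : set V) (hP : subspace P).

Lemma subspaceZ a x : P x -> P (a *: x).
Proof. by move=> Px; rewrite -[a *: x]addr0; apply: hP.2 => //; exact: hP.1. Qed.

Lemma subspaceD x y : P x -> P y -> P (x + y).
Proof. by move=> Px Py; rewrite -[x]scale1r; exact: hP.2. Qed.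

Lemma subspaceB x y : P x -> P y -> P (x - y).
Proof. by move=> Px Py; rewrite -scaleN1r; apply: subspaceD => //; exact: subspaceZ. Qed.

Lemma subspace_sum J (r : seq J) (Q : pred J) (F : J -> V) :
  (forall j, Q j -> P (F j)) -> P (\sum_(j <- r | Q j) F j).
Proof. by move=> h; apply: big_ind => //; [exact: hP.1 | exact: subspaceD]. Qed.

End Subspaces.

Lemma subspaceT V : subspace [set: V].
Proof. by []. Qed.

Lemma subspace0 V : subspace [set 0 : V].
Proof. by split=> // a x y -> ->; rewrite scaler0 addr0. Qed.

Lemma subspaceI V (P Q : set V) : subspace P -> subspace Q -> subspace (P `&` Q).
Proof.
move=> hP hQ; split=> [|a x y [Px Qx] [Py Qy]]; first by split; [exact: hP.1|exact: hQ.1].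
by split; [exact: hP.2|exact: hQ.2].
Qed.

Lemma subspace_preimage V W (f : {linear V -> W}) (P : set W) :
  subspace P -> subspace (f @^-1` P).
Proof.
move=> hP; split=> [|a x y Px Py]; first by rewrite /preimage /= linear0; exact: hP.1.
by rewrite /preimage /= linearP; apply: hP.2.
Qed.

Lemma subspace_ker V W (f : {linear V -> W}) : subspace [set x | f x = 0].
Proof. exact: (subspace_preimage f (subspace0 W)). Qed.

Lemma subspace_image V W (f : {linear V -> W}) (P : set V) :
  subspace P -> subspace (f @` P).
Proof.
move=> hP; split=> [|a _ _ [x Px <-] [y Py <-]].
  by exists 0; [exact: hP.1|rewrite linear0].
by exists (a *: x + y); [exact: hP.2|rewrite linearP].
Qed.

Lemma subspace_range V W (f : {linear V -> W}) : subspace (range f).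
Proof. exact: subspace_image. Qed.

Definition lspan V n (x : 'I_n -> V) : set V :=
  [set w | exists a : 'I_n -> K, w = \sum_i a i *: x i].

Definition lfree V n (x : 'I_n -> V) : Prop :=
  forall a : 'I_n -> K, \sum_i a i *: x i = 0 -> forall i, a i = 0.

Lemma subspace_lspan V n (x : 'I_n -> V) : subspace (lspan x).
Proof.
split=> [|c _ _ [a ->] [b ->]].
  by exists (fun=> 0); rewrite big1 // => i _; rewrite scale0r.
exists (fun i => c * a i + b i); rewrite scaler_sumr -big_split /=.
by apply: eq_bigr => i _; rewrite scalerDl scalerA.
Qed.

Lemma lspan_gen V n (x : 'I_n -> V) i : lspan x (x i).
Proof.
exists (fun k => (k == i)%:R); rewrite (bigD1 i) //= eqxx scale1r big1 ?addr0 // => k.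
by move=> /negbTE ->; rewrite scale0r.
Qed.

Lemma dual0 V (f : dual V) : f 0 = 0.
Proof. by have := dual_linear f (-1) 0 0; rewrite scaler0 addr0 scaleN1r addNr. Qed.

Lemma dualD V (f : dual V) x y : f (x + y) = f x + f y.
Proof. by have := dual_linear f 1 x y; rewrite !scale1r. Qed.

Lemma dualZ V (f : dual V) a x : f (a *: x) = a * f x.
Proof. by have := dual_linear f a x 0; rewrite dual0 !addr0. Qed.

Lemma dualB V (f : dual V) x y : f (x - y) = f x - f y.
Proof. by rewrite dualD -scaleN1r dualZ mulN1r. Qed.

(* A subspace containing [P] that is maximal among those avoiding [v] is a
   complement of the line through [v]. *)
Lemma dual_separates V (P : set V) v : subspace P -> ~ P v ->
  exists f : dual V, f v = 1 /\ forall x, P x -> f x = 0.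
Proof.
move=> hP nPv.
pose G : set (set V) := [set A | A = set0 \/ [/\ subspace A, P `<=` A & ~ A v]].
have [|A [GA maxA]] := @Zorn_bigcup V G.
  move=> F FG tot; have [[A0 [FA0 A0n]]|F0] := pselect (exists A, F A /\ A !=set0); last first.
    left; apply/seteqP; split=> // x [A FA Ax]; apply: F0; exists A; split=> //.
    by exists x.
  have Fne A x : F A -> A x -> [/\ subspace A, P `<=` A & ~ A v].
    by move=> FA Ax; case: (FG A FA) => // A0E; rewrite A0E in Ax.
  have [x0 A0x0] := A0n; have [s0 P0 _] := Fne _ _ FA0 A0x0.
  right; split.
  - split; first by exists A0 => //; exact: s0.1.
    move=> a x y [A FA Ax] [B FB By].
    have [AB|BA] := tot A B FA FB.
      by exists B => //; have [sB _ _] := Fne _ _ FB By; apply: sB.2 => //; exact: AB.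
    by exists A => //; have [sA _ _] := Fne _ _ FA Ax; apply: sA.2 => //; exact: BA.
  - by move=> x Px; exists A0 => //; exact: P0.
  - by move=> [A FA Av]; have [_ _ /(_ Av)] := Fne _ _ FA Av.
have [sA PA nAv] : [/\ subspace A, P `<=` A & ~ A v].
  case: GA => // A0; exfalso; apply: (maxA P); last by right; split.
  rewrite A0; split=> // /(_ 0 hP.1); exact.
have dec w : exists a, A (w - a *: v).
  have [Aw|nAw] := pselect (A w); first by exists 0; rewrite scale0r subr0.
  (* By maximality A + Kw contains v, say v = b w + p; here b is nonzero because v is not in A, and
     one solves for w. *)
  pose B : set V := [set z | exists b p, A p /\ z = b *: w + p].
  have sB : subspace B.
    split; first by exists 0, 0; split; [exact: sA.1|rewrite scale0r addr0].
    move=> c _ _ [b [p [Ap ->]]] [b' [p' [Ap' ->]]].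
    exists (c * b + b'), (c *: p + p'); split; first exact: sA.2.
    by rewrite scalerDr scalerDl !scalerA addrACA.
  have AB : A `<` B.
    split; first by move=> p Ap; exists 0, p; rewrite scale0r add0r.
    move=> /(_ w) h; apply: nAw; apply: h; exists 1, 0; rewrite scale1r addr0; split=> //.
    exact: sA.1.
  have : B v.
    apply: contrapT => nBv; apply: (maxA _ AB); right; split=> // p /PA Ap.
    by exists 0, p; rewrite scale0r add0r.
  move=> [b [p [Ap vE]]].
  have b0 : b != 0 by apply/eqP => b0; apply: nAv; rewrite vE b0 scale0r add0r.
  exists b^-1; have -> : w - b^-1 *: v = (- b^-1) *: p.
    by rewrite vE scalerDr scalerA mulVf // scale1r opprD addNKr scaleNr.
  exact: subspaceZ.
have uniqA a w : A (w - a *: v) -> forall b, A (w - b *: v) -> a = b.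
  move=> ha b hb; apply/eqP; rewrite -subr_eq0; apply/eqP; apply: contrapT => /eqP ab0.
  apply: nAv; have -> : v = (a - b)^-1 *: ((w - b *: v) - (w - a *: v)).
    by rewrite opprB [X in _ *: X]addrC subrKA -scalerBl scalerA mulVf // scale1r.
  by apply: subspaceZ => //; exact: subspaceB.
have [f fP] := choice dec.
have lf : linear (f : V -> K^o).
  move=> a x y; apply: (uniqA _ (a *: x + y)) => //.
  rewrite scalerDl -scalerA opprD addrACA -scalerBr.
  by apply: sA.2; exact: fP.
exists (in_sub _ lf); split.
  by apply: (uniqA _ v) => //; rewrite scale1r subrr; exact: sA.1.
by move=> x Px; apply: (uniqA _ x) => //; rewrite scale0r subr0; exact: PA.
Qed.

Lemma dual_separates0 V (v : V) : (forall f : dual V, f v = 0) -> v = 0.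
Proof.
move=> h; apply: contrapT => nv; have [f [fv _]] := dual_separates (subspace0 V) nv.
by move: (h f) => /eqP; rewrite fv oner_eq0.
Qed.

Lemma dual_bilin V (f : dual V) W : bilin (fun (v : V) (w : W) => f v *: w).
Proof.
split=> [w a x y|v a x y]; first by rewrite dual_linear scalerDl scalerA.
by rewrite scalerDr !scalerA mulrC.
Qed.

(** For the coaction of a comodule this is the action of [f]: [act f m] unfolds to
    [contract f (coact M m)]. *)
Definition contract V W (f : dual V) : tens V W -> W := tlift (fun v w => f v *: w).
HB.instance Definition _ V W (f : dual V) :=
  GRing.isLinear.Build K _ _ _ (@contract V W f) (tlift_linear (dual_bilin f W)).

Arguments contract : simpl never.

Lemma contractE V W (f : dual V) (v : V) (w : W) : contract f (tmk v w) = f v *: w.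
Proof. exact: (tlift_mk _ _ (dual_bilin f W)). Qed.

Lemma tmkDl V W (v v' : V) (w : W) : tmk (v + v') w = tmk v w + tmk v' w.
Proof. by have := (tmk_bilin V W).1 w 1 v v'; rewrite !scale1r. Qed.

Lemma tmkDr V W (v : V) (w w' : W) : tmk v (w + w') = tmk v w + tmk v w'.
Proof. by have := (tmk_bilin V W).2 v 1 w w'; rewrite !scale1r. Qed.

Lemma tmk0 V W (v : V) : tmk v (0 : W) = 0.
Proof. by have := (tmk_bilin V W).2 v (-1) 0 0; rewrite scaler0 addr0 scaleN1r addNr. Qed.

Lemma tmk0l V W (w : W) : tmk (0 : V) w = 0.
Proof. by have := (tmk_bilin V W).1 w (-1) 0 0; rewrite scaler0 addr0 scaleN1r addNr. Qed.

Lemma tmkZr V W (v : V) a (w : W) : tmk v (a *: w) = a *: tmk v w.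
Proof. by have := (tmk_bilin V W).2 v a w 0; rewrite tmk0 !addr0. Qed.

Lemma tmkZl V W a (v : V) (w : W) : tmk (a *: v) w = a *: tmk v w.
Proof. by have := (tmk_bilin V W).1 w a v 0; rewrite tmk0l !addr0. Qed.

Lemma tmk_suml V W J (r : seq J) (F : J -> V) (w : W) :
  tmk (\sum_(j <- r) F j) w = \sum_(j <- r) tmk (F j) w.
Proof. by apply: (big_morph (fun v => tmk v w)); [move=> x y; exact: tmkDl|exact: tmk0l]. Qed.

Lemma tens_sum_ord V W (t : tens V W) :
  exists n (v : 'I_n -> V) (w : 'I_n -> W), t = \sum_i tmk (v i) (w i).
Proof.
exists (size (repr t)), (fun i => (tnth (in_tuple (repr t)) i).1),
  (fun i => (tnth (in_tuple (repr t)) i).2).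
by rewrite {1}(tens_sum t) big_tnth.
Qed.

(* A shortest representation of a tensor has linearly independent left factors. *)
Lemma tens_free_repr V W (t : tens V W) :
  exists n (v : 'I_n -> V) (w : 'I_n -> W),
    t = \sum_i tmk (v i) (w i) /\ forall i, exists f : dual V, forall k, f (v k) = (k == i)%:R.
Proof.
pose Q n := `[< exists (v : 'I_n -> V) (w : 'I_n -> W), t = \sum_i tmk (v i) (w i) >].
have exQ : exists n, Q n.
  by have [n [v [w h]]] := tens_sum_ord t; exists n; apply/asboolP; exists v, w.
case: (ex_minnP exQ) => n /asboolP [v [w tE]] minn.
exists n, v, w; split=> // i.
case: n i v w tE minn => [[]//|n] i v w tE minn.
have ns : ~ lspan (fun k => v (lift i k)) (v i).
  move=> [a vi]; suff /minn : Q n by rewrite ltnn.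
  apply/asboolP; exists (fun k => v (lift i k)), (fun k => a k *: w i + w (lift i k)).
  rewrite tE (bigD1_ord i) //= vi tmk_suml -big_split /=.
  by apply: eq_bigr => k _; rewrite tmkDr tmkZl tmkZr.
have [f [f1 f0]] := dual_separates (subspace_lspan _) ns.
exists f => k; case: (unliftP i k) => [j ->|->]; last by rewrite eqxx.
by rewrite eq_sym (negbTE (neq_lift _ _)); apply: f0; exact: (lspan_gen (fun k => v (lift i k))).
Qed.

(** In a representation with independent left factors, the form dual to the i-th one isolates the
    i-th right factor, so each right factor is 0. *)
Lemma tens_separated V W (t : tens V W) : (forall f : dual V, contract f t = 0) -> t = 0.
Proof.
have [n [v [w [-> hv]]]] := tens_free_repr t => h.
apply: big1 => i _; have [f fv] := hv i; have := h f.
rewrite linear_sum (bigD1 i) //= contractE fv eqxx scale1r big1 ?addr0 => [->|k /negbTE ki].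
  exact: tmk0.
by rewrite contractE fv ki scale0r.
Qed.

Lemma tens_eq V W (t u : tens V W) : (forall f : dual V, contract f t = contract f u) -> t = u.
Proof.
move=> h; apply/eqP; rewrite -subr_eq0; apply/eqP; apply: tens_separated => f.
by rewrite linearB /= h subrr.
Qed.

End LinearAlgebra.

(** * Dimensions of subspaces *)

Section Dimension.
Variable K : fieldType.
Implicit Types U V W : lmodType K.

Lemma has_dimP V (Z : set V) n : subspace Z ->
  has_dim Z n <-> exists x : 'I_n -> V, [/\ forall i, Z (x i), lfree x & Z `<=` lspan x].
Proof.
move=> hZ; split=> [[x [Zx ux]]|[x [Zx fx sx]]]; exists x.
  have Z0 : Z 0 by exact: hZ.1.
  split=> // [a a0 i|z Zz].
    have [b [_ bu]] := ux 0 Z0.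
    have e (c : {ffun 'I_n -> K}) : \sum_i c i *: x i = 0 -> b = c.
      by move=> c0; apply: bu; rewrite /= c0 subrr.
    rewrite -[a i](ffunE a i) -(e [ffun i => a i]); last first.
      by rewrite -[RHS]a0; apply: eq_bigr => j _; rewrite ffunE.
    rewrite (e [ffun => 0]) ?ffunE // big1 // => j _.
    by rewrite ffunE scale0r.
  by have [b [/= /eqP bz _]] := ux z Zz; exists b; apply/eqP; rewrite -subr_eq0.
split=> // z Zz; have [a zE] := sx z Zz.
exists [ffun i => a i]; split=> [|b /= zb].
  by rewrite /= zE -sumrB big1 // => i _; rewrite ffunE subrr.
apply/ffunP => i; rewrite ffunE; apply/eqP; rewrite -subr_eq0; apply/eqP.
apply: (fx (fun i => a i - b i)); rewrite -[RHS]zb zE -sumrB.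
by apply: eq_bigr => j _; rewrite scalerBl.
Qed.

Lemma ker0_leq m n (A : 'M[K]_(m, n)) : (forall u : 'rV_m, u *m A = 0 -> u = 0) -> (m <= n)%N.
Proof.
move=> h; have : row_free A.
  rewrite -kermx_eq0; apply/eqP/row_matrixP => i; rewrite row0; apply: h.
  by rewrite -row_mul mulmx_ker row0.
by rewrite /row_free => /eqP <-; exact: rank_leq_col.
Qed.

Lemma lfree_leq V m n (x : 'I_m -> V) (y : 'I_n -> V) :
  lfree x -> (forall i, lspan y (x i)) -> (m <= n)%N.
Proof.
move=> fx /choice[A xE]; apply: (@ker0_leq _ _ (\matrix_(i, j) A i j)) => u u0.
apply/rowP => i; rewrite mxE; apply: (fx (u 0)).
under eq_bigr => k _ do rewrite xE scaler_sumr.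
rewrite exchange_big big1 //= => j _.
transitivity ((u *m \matrix_(i, j) A i j) 0 j *: y j); last by rewrite u0 mxE scale0r.
rewrite mxE scaler_suml; apply: eq_bigr => k _.
by rewrite mxE scalerA.
Qed.

Lemma has_dim_uniq V (Z : set V) m n : subspace Z -> has_dim Z m -> has_dim Z n -> m = n.
Proof.
move=> hZ /(has_dimP _ hZ)[x [Zx fx sx]] /(has_dimP _ hZ)[y [Zy fy sy]].
by apply/eqP; rewrite eqn_leq (lfree_leq fx (fun i => sy _ (Zx i)))
  (lfree_leq fy (fun i => sx _ (Zy i))).
Qed.

Lemma has_dim_dimK V (Z : set V) : findim Z -> has_dim Z (dimK Z).
Proof. by rewrite /dimK; case: xgetP => [n -> //|h [n Zn]]; case: (h n). Qed.

Lemma dimK_eq V (Z : set V) n : subspace Z -> has_dim Z n -> dimK Z = n.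
Proof. by move=> hZ Zn; apply: (has_dim_uniq hZ) => //; apply: has_dim_dimK; exists n. Qed.

Definition lcons V n (v : V) (x : 'I_n -> V) (i : 'I_n.+1) : V :=
  if unlift ord0 i is Some k then x k else v.

Lemma lcons0 V n (v : V) (x : 'I_n -> V) : lcons v x ord0 = v.
Proof. by rewrite /lcons unlift_none. Qed.

Lemma lconsS V n (v : V) (x : 'I_n -> V) k : lcons v x (lift ord0 k) = x k.
Proof. by rewrite /lcons liftK. Qed.

Lemma sum_lcons V n (v : V) (x : 'I_n -> V) (a : 'I_n.+1 -> K) :
  \sum_i a i *: lcons v x i = a ord0 *: v + \sum_i a (lift ord0 i) *: x i.
Proof.
by rewrite big_ord_recl lcons0; under eq_bigr => i _ do rewrite lconsS.
Qed.

Lemma lfree_cons V n (v : V) (x : 'I_n -> V) : lfree x -> ~ lspan x v -> lfree (lcons v x).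
Proof.
move=> fx nv a; rewrite sum_lcons => a0.
have a00 : a ord0 = 0.
  apply: contrapT => /eqP an; apply: nv.
  exists (fun i => - (a ord0)^-1 * a (lift ord0 i)).
  under eq_bigr => i _ do rewrite -scalerA.
  rewrite -scaler_sumr; move/eqP: a0; rewrite addrC addr_eq0 => /eqP ->.
  by rewrite scalerN scaleNr opprK scalerA mulVf // scale1r.
move: a0; rewrite a00 scale0r add0r => a0 i.
by case: (unliftP ord0 i) => [k ->|-> //]; exact: (fx (fun k => a (lift ord0 k))).
Qed.

(** A free family of maximal length spans, as a vector outside its span could be added to it.
    Bounding free families is thus enough for finite dimension. *)
Lemma has_dim_bounded V (P : set V) n : subspace P ->
  (forall m (x : 'I_m -> V), (forall i, P (x i)) -> lfree x -> (m <= n)%N) ->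
  exists2 m, (m <= n)%N & has_dim P m.
Proof.
move=> hP bP.
pose Q m := `[< exists x : 'I_m -> V, (forall i, P (x i)) /\ lfree x >].
have exQ : exists m, Q m.
  exists 0%N; apply/asboolP; exists (fun=> 0).
  by split=> [[]|? _ []].
have bQ m : Q m -> (m <= n)%N by move=> /asboolP[x [Px fx]]; exact: (bP m x).
case: (ex_maxnP exQ bQ) => m Qm maxm; exists m; first exact: bQ.
move: Qm => /asboolP[x [Px fx]]; apply/has_dimP => //.
exists x; split=> // v Pv; apply: contrapT => nv.
suff /maxm : Q m.+1 by rewrite ltnn.
apply/asboolP; exists (lcons v x); split; last exact: lfree_cons.
by move=> i; case: (unliftP ord0 i) => [k ->|->]; rewrite ?lconsS ?lcons0.
Qed.

Lemma has_dim_sub V (Z P : set V) n : subspace Z -> subspace P -> P `<=` Z ->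
  has_dim Z n -> exists2 m, (m <= n)%N & has_dim P m.
Proof.
move=> hZ hP PZ /(has_dimP _ hZ)[z [Zz fz sz]]; apply: has_dim_bounded => // m x Px fx.
by apply: (lfree_leq fx (y := z)) => i; apply/sz/PZ.
Qed.

Lemma has_dim_sub_eq V (Z P : set V) n : subspace Z -> subspace P -> P `<=` Z ->
  has_dim Z n -> has_dim P n -> P = Z.
Proof.
move=> hZ hP PZ /(has_dimP _ hZ)[z [Zz fz sz]] /(has_dimP _ hP)[x [Px fx sx]].
apply/seteqP; split=> // v Zv; apply: contrapT => nPv.
suff : (n.+1 <= n)%N by rewrite ltnn.
apply: (@lfree_leq _ _ _ (lcons v x) z) => [|i].
  apply: lfree_cons => // -[a vE]; apply: nPv; rewrite vE.
  by apply: subspace_sum => // k _; exact: subspaceZ.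
by apply: sz; case: (unliftP ord0 i) => [k ->|->]; rewrite ?lconsS ?lcons0 //; exact: PZ.
Qed.

Lemma linear_sumZ V W (f : {linear V -> W}) n (a : 'I_n -> K) (x : 'I_n -> V) :
  f (\sum_i a i *: x i) = \sum_i a i *: f (x i).
Proof. by rewrite linear_sum; apply: eq_bigr => i _; rewrite linearZ. Qed.

Lemma has_dim_image V W (f : {linear V -> W}) (Z : set V) n : subspace Z ->
  has_dim Z n -> exists2 m, (m <= n)%N & has_dim (f @` Z) m.
Proof.
move=> hZ /(has_dimP _ hZ)[z [Zz fz sz]].
apply: (has_dim_bounded (subspace_image f hZ)) => m y Zy fy.
have /choice[x xP] : forall i, exists x, Z x /\ f x = y i.
  by move=> i; have [x Zx <-] := Zy i; exists x.
apply: (@lfree_leq _ _ _ x z) => [a a0|i]; last exact/sz/(xP i).1.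
apply: fy; transitivity (f (\sum_i a i *: x i)); last by rewrite a0 linear0.
by rewrite linear_sumZ; apply: eq_bigr => i _; rewrite (xP i).2.
Qed.

(** Rank and nullity, in the direction that yields finiteness of [Z] from that of kernel and image:
    a basis of the kernel is joined to lifts of a basis of the image. *)
Lemma has_dim_ker_image V W (f : {linear V -> W}) (Z : set V) a b : subspace Z ->
  has_dim (Z `&` [set x | f x = 0]) a -> has_dim (f @` Z) b -> has_dim Z (a + b).
Proof.
move=> hZ /(has_dimP _ (subspaceI hZ (subspace_ker f)))[x [Zx fx sx]].
move=> /(has_dimP _ (subspace_image f hZ))[y [Zy fy sy]].
have /choice[z zP] : forall i, exists z, Z z /\ f z = y i.
  by move=> i; have [z Zz <-] := Zy i; exists z.
apply/has_dimP => //.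
exists (fun i => match fintype.split i with inl k => x k | inr k => z k end).
have E (c : 'I_(a + b) -> K) :
    \sum_i c i *: (match fintype.split i with inl k => x k | inr k => z k end) =
    \sum_i c (lshift b i) *: x i + \sum_i c (rshift a i) *: z i.
  rewrite big_split_ord; congr (_ + _); apply: eq_bigr => i _.
    by rewrite (unsplitK (inl i)).
  by rewrite (unsplitK (inr i)).
split.
- by move=> i; case: fintype.split => k; [exact: (Zx k).1|exact: (zP k).1].
- move=> c; rewrite E => c0.
  have fx0 : f (\sum_i c (lshift b i) *: x i) = 0.
    by rewrite linear_sumZ big1 // => i _; rewrite (Zx i).2 scaler0.
  have cr : forall i, c (rshift a i) = 0.
    apply: (fy (fun i => c (rshift a i))).
    have := congr1 f c0; rewrite linear0 linearD fx0 add0r linear_sumZ => e.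
    by rewrite -[RHS]e; apply: eq_bigr => i _; rewrite (zP i).2.
  have cl : forall i, c (lshift b i) = 0.
    apply: (fx (fun i => c (lshift b i))).
    by rewrite -[RHS]c0 [X in _ + X]big1 ?addr0 // => i _; rewrite cr scale0r.
  by move=> i; case: (split_ordP i) => k ->.
- move=> v Zv; have [d dE] := sy (f v) (imageP f Zv).
  have [|c cE] := sx (v - \sum_i d i *: z i).
    split; last by rewrite /= linearB linear_sumZ dE -sumrB big1 // => i _; rewrite (zP i).2 subrr.
    apply: subspaceB => //; apply: subspace_sum => // i _; apply: subspaceZ => //.
    exact: (zP i).1.
  exists (fun i => match fintype.split i with inl k => c k | inr k => d k end).
  rewrite E -[v](subrK (\sum_i d i *: z i)) cE; congr (_ + _); apply: eq_bigr => i _.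
    by rewrite (unsplitK (inl i)).
  by rewrite (unsplitK (inr i)).
Qed.

Lemma has_dim0 V : has_dim [set 0 : V] 0.
Proof.
apply/has_dimP; first exact: subspace0.
exists (fun=> 0); split=> [//|? _ [] //|_ ->].
by exists (fun=> 0); rewrite big_ord0.
Qed.

Lemma has_dim_inj V W (f : {linear V -> W}) (Z : set V) n : subspace Z ->
  (forall x, Z x -> f x = 0 -> x = 0) -> has_dim Z n <-> has_dim (f @` Z) n.
Proof.
move=> hZ fI; have ker0 : Z `&` [set x | f x = 0] = [set 0].
  apply/seteqP; split=> [x [Zx fx]|_ ->]; first exact: fI.
  by split; [exact: hZ.1|rewrite /= linear0].
have d0 : has_dim (Z `&` [set x | f x = 0]) 0 by rewrite ker0; exact: has_dim0.
split=> [Zn|fZn]; last by rewrite -[n]add0n; exact: (has_dim_ker_image hZ d0 fZn).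
have [m _ fZm] := has_dim_image f hZ Zn.
by rewrite (has_dim_uniq hZ Zn (has_dim_ker_image hZ d0 fZm)).
Qed.

Lemma has_dim_rV n : has_dim [set: 'rV[K]_n] n.
Proof.
apply/has_dimP; first exact: subspaceT.
exists (fun i => delta_mx 0 i); split=> // [a a0 i|v _]; last first.
  by exists (v 0); rewrite -row_sum_delta.
have : (\row_i a i) 0 i = 0; last by rewrite mxE.
suff -> : \row_i a i = 0 by rewrite mxE.
by rewrite -[RHS]a0 (row_sum_delta (\row_i a i)); apply: eq_bigr => j _; rewrite mxE.
Qed.

(** * Dimensions through bilinear pairings *)

Section Pairing.
Variables (V W : lmodType K) (b : V -> W -> K^o) (hb : bilin b).
Variables (P : set V) (H : set W) (hP : subspace P) (hH : subspace H).
Hypothesis b_faithful_l : forall x, P x -> (forall h, H h -> b x h = 0) -> x = 0.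
Hypothesis b_faithful_r : forall h, H h -> (forall x, P x -> b x h = 0) -> h = 0.

Lemma bilin_suml n (a : 'I_n -> K) (x : 'I_n -> V) h :
  b (\sum_i a i *: x i) h = \sum_i a i *: b (x i) h.
Proof. exact: (linear_sumZ (to_linear (hb.1 h))). Qed.

Lemma bilin_sumr n (a : 'I_n -> K) x (h : 'I_n -> W) :
  b x (\sum_i a i *: h i) = \sum_i a i *: b x (h i).
Proof. exact: (linear_sumZ (to_linear (hb.2 x))). Qed.

Lemma pairing_bound n : has_dim H n -> exists2 m, (m <= n)%N & has_dim P m.
Proof.
move=> /(has_dimP _ hH)[h [Hh fh sh]]; apply: has_dim_bounded => // m x Px fx.
apply: (@ker0_leq _ _ (\matrix_(i, j) (b (x i) (h j) : K))) => u u0.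
apply/rowP => i; rewrite mxE; apply: (fx (u 0)).
apply: b_faithful_l => [|w /sh[c ->]].
  by apply: subspace_sum => // k _; exact: subspaceZ.
rewrite bilin_sumr big1 // => j _; rewrite bilin_suml.
suff -> : \sum_k u 0 k *: b (x k) (h j) = 0 by rewrite scaler0.
transitivity ((u *m \matrix_(i, j) (b (x i) (h j) : K)) 0 j); last by rewrite u0 mxE.
by rewrite mxE; apply: eq_bigr => k _; rewrite mxE.
Qed.

(* The bound holds because pairing with a basis of [H] embeds [P] into the rows of length n. Applied
   in both directions, it yields equality of dimensions. *)
End Pairing.

Lemma bilinC V W (b : V -> W -> K^o) : bilin b -> bilin (fun w v => b v w).
Proof. by move=> [h1 h2]; split. Qed.

Lemma pairing_dim V W (b : V -> W -> K^o) (P : set V) (H : set W) n :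
  bilin b -> subspace P -> subspace H ->
  (forall x, P x -> (forall h, H h -> b x h = 0) -> x = 0) ->
  (forall h, H h -> (forall x, P x -> b x h = 0) -> h = 0) ->
  has_dim H n -> has_dim P n.
Proof.
move=> hb hP hH bl br Hn; have [m mn Pm] := pairing_bound hb hP hH bl Hn.
have [k km Hk] := pairing_bound (bilinC hb) hH hP br Pm.
by rewrite (_ : n = m) //; apply/eqP; rewrite eqn_leq mn andbT (has_dim_uniq hH Hn Hk).
Qed.

(** Evaluation at a basis of [H'] is a linear map on [P] whose kernel is the annihilator. It is
    onto: a row orthogonal to its image is the coefficient row of an element of [H'] killed by all
    of [P], hence zero. *)
Lemma pairing_annihilator V W (b : V -> W -> K^o) (P : set V) (H H' : set W) n n' :
  bilin b -> subspace P -> subspace H -> subspace H' -> H' `<=` H ->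
  (forall x, P x -> (forall h, H h -> b x h = 0) -> x = 0) ->
  (forall h, H h -> (forall x, P x -> b x h = 0) -> h = 0) ->
  has_dim H n -> has_dim H' n' ->
  exists2 m, (m + n')%N = n & has_dim [set x | P x /\ forall h, H' h -> b x h = 0] m.
Proof.
move=> hb hP hH hH' H'H bl br Hn /(has_dimP _ hH')[h [Hh fh sh]].
have Pn := pairing_dim hb hP hH bl br Hn.
have lf : linear (fun x => \row_i (b x (h i) : K)).
  by move=> a x y; apply/rowP => i; rewrite !mxE hb.1.
pose f := to_linear lf.
have kE : P `&` [set x | f x = 0] = [set x | P x /\ forall h, H' h -> b x h = 0].
  apply/seteqP; split=> x [Px x0]; split=> //; last first.
    by apply/rowP => i; rewrite !mxE x0.
  move=> w /sh[a ->]; rewrite (bilin_sumr hb) big1 // => i _.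
  by have := congr1 (fun u : 'rV_n' => u 0 i) x0; rewrite !mxE => ->; rewrite scaler0.
have [m _ km] : exists2 m, (m <= n)%N & has_dim (P `&` [set x | f x = 0]) m.
  by apply: (has_dim_sub hP (subspaceI hP (subspace_ker f)) _ Pn) => x [].
exists m; last by rewrite -kE.
apply: (has_dim_uniq hP) => //; apply: (has_dim_ker_image hP km).
pose dot (u v : 'rV[K]_n') : K^o := \sum_i u 0 i * v 0 i.
have hdot : bilin dot.
  split=> [w a x y|v a x y]; rewrite /dot scaler_sumr -big_split /=; apply: eq_bigr => i _.
    by rewrite !mxE mulrDl -mulrA.
  by rewrite !mxE mulrDr mulrCA.
apply: (pairing_dim hdot (subspace_image f hP) (@subspaceT K 'rV_n')) (has_dim_rV n').
  move=> u _ u0; apply/rowP => i; rewrite mxE.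
  rewrite -[RHS](u0 (delta_mx 0 i)) // /dot (bigD1 i) //= mxE !eqxx mulr1.
  by rewrite big1 ?addr0 // => k /negbTE ki; rewrite mxE ki andbF mulr0.
move=> v _ v0; apply/rowP => i; rewrite mxE; apply: (fh (v 0)).
apply: br => [|x Px].
  by apply: subspace_sum => // k _; apply: subspaceZ => //; exact: H'H.
rewrite (bilin_sumr hb); rewrite -[RHS](v0 (f x)) //.
by apply: eq_bigr => k _; rewrite mxE mulrC.
Qed.

End Dimension.

(** * Comodules as modules over the convolution algebra *)

Section ComoduleBuilder.
Variables (K : fieldType) (C : coalgebra K) (s : side) (P : lmodType K).
Variable rho : {linear P -> tens C P}.
Hypothesis rho1 : forall m, contract (conv1 C) (rho m) = m.
Hypothesis rhoM : forall f g m,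
  contract (conv s f g) (rho m) = contract g (rho (contract f (rho m))).

(** Two successive contractions determine a tensor with two factors [C]. Tested in this way,
    coassociativity becomes associativity of the action, so a locally finite module structure given
    by [rho] is a comodule. *)
Lemma contract_conv f g (t : tens C P) :
  contract g (contract f (tassoc (tmap (comult_at C s) idfun t))) =
  contract (conv s f g) t.
Proof.
have l1 : linear (fun t : tens C P =>
    contract g (contract f (tassoc (tmap (comult_at C s) idfun t)))).
  by move=> a x y; rewrite !linearP.
have l0 : linear (fun t : tens C P => contract (conv s f g) t).
  by move=> a x y; rewrite linearP.
apply: (tens_lin_ext l1 l0) => c n.
rewrite tmapE [RHS]contractE {1}/conv /dual_fun /=; move: (comult_at C s c) => u.
have l2 : linear (fun u : tens C C => contract g (contract f (tassoc (tmk u n)))).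
  by move=> a x y; rewrite (tmk_bilin _ _).1 !linearP.
have l3 : linear (fun u : tens C C => tlift (fun a b => f a * g b : K^o) u *: n).
  by move=> a x y; rewrite (tlift_linear (conv_bilin f g)) scalerDl scalerA.
apply: (tens_lin_ext l2 l3) => a b.
by rewrite tassocE !contractE linearZ /= contractE (tlift_mk _ _ (conv_bilin f g)) scalerA.
Qed.

Lemma contract_tmap (V : lmodType K) (rho' : {linear P -> V}) (f : dual C) (t : tens C P) :
  contract f (tmap idfun rho' t) = rho' (contract f t).
Proof.
have l1 : linear (fun t : tens C P => contract f (tmap idfun rho' t)).
  by move=> a x y; rewrite !linearP.
have l2 : linear (fun t : tens C P => rho' (contract f t)).
  by move=> a x y; rewrite !linearP.
apply: (tens_lin_ext l1 l2) => c n.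
by rewrite tmapE !contractE linearZ.
Qed.

Fact build_coactA m :
  tassoc (tmap (comult_at C s) idfun (rho m)) = tmap idfun rho (rho m).
Proof.
apply: tens_eq => f; apply: tens_eq => g.
by rewrite contract_conv contract_tmap rhoM.
Qed.

Definition build_comodule : comodule C s := @Comodule _ C s P rho build_coactA rho1.

End ComoduleBuilder.

Section Homs.
Variables (K : fieldType) (C : coalgebra K) (s : side).
Implicit Types (L M N Q E : comodule C s).

Lemma hom_linear M N (f : HomC M N) : linear (f : M -> N).
Proof. by have /asboolP[] := sub_valP f. Qed.

HB.instance Definition _ M N (f : HomC M N) :=
  GRing.isLinear.Build K M N _ (hom_fun f) (hom_linear f).

HB.instance Definition _ M (f : dual C) :=
  GRing.isLinear.Build K M M _ (@act K C s M f) (@act_linear K C s M f).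

Lemma hom_eq M N (f g : HomC M N) : (forall x, f x = g x) -> f = g.
Proof. by move=> h; apply/val_inj/funext. Qed.

Section MkHom.
Variables (M N : comodule C s) (f : M -> N) (lf : linear f).
Hypothesis fact : forall (phi : dual C) m, f (act phi m) = act phi (f m).

Fact mkHom_proof : linear f /\
  forall m, coact N (f m) = tlift (fun c x => tmk c (f x)) (coact M m).
Proof.
split=> // m; apply: tens_eq => phi.
rewrite -[LHS]/(act phi (f m)) -fact -[LHS]/(to_linear lf (contract phi (coact M m))).
by rewrite -contract_tmap.
Qed.

Definition mkHom : HomC M N := in_sub _ mkHom_proof.

Lemma mkHomE x : mkHom x = f x.
Proof. by []. Qed.

End MkHom.

Definition idC M : HomC M M := @mkHom M M id (fun _ _ _ => erefl) (fun _ _ => erefl).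

Lemma compC_linear L M N (g : HomC M N) (f : HomC L M) : linear (fun x => g (f x)).
Proof. by move=> a x y; rewrite !linearP. Qed.
Lemma compC_act L M N (g : HomC M N) (f : HomC L M) (phi : dual C) x :
  g (f (act phi x)) = act phi (g (f x)).
Proof. by rewrite !act_hom. Qed.
Definition compC L M N (g : HomC M N) (f : HomC L M) : HomC L N :=
  mkHom (@compC_linear L M N g f) (@compC_act L M N g f).

Lemma compCE L M N (g : HomC M N) (f : HomC L M) x : compC g f x = g (f x).
Proof. by []. Qed.

Lemma hom0E M N x : (0 : HomC M N) x = 0.
Proof. by []. Qed.
Lemma homDE M N (f g : HomC M N) x : (f + g : HomC M N) x = f x + g x.
Proof. by []. Qed.
Lemma homBE M N (f g : HomC M N) x : (f - g : HomC M N) x = f x - g x.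
Proof. by []. Qed.
Lemma homPE M N a (f g : HomC M N) x : (a *: f + g : HomC M N) x = a *: f x + g x.
Proof. by []. Qed.

Lemma homB M N (f : HomC M N) x y : f (x - y) = f x - f y.
Proof. exact: linearB. Qed.

Lemma mono_ker M N (f : HomC M N) : (forall x, f x = 0 -> x = 0) -> mono f.
Proof.
move=> h x y exy; apply/eqP; rewrite -subr_eq0; apply/eqP/h.
by rewrite linearB /= exy subrr.
Qed.

Lemma mono0 M N (f : HomC M N) x : mono f -> f x = 0 -> x = 0.
Proof. by move=> fI fx; apply: fI; rewrite fx linear0. Qed.

Lemma hom_lift L M N (i : HomC N M) (f : HomC L M) : mono i ->
  (forall x, range i (f x)) -> exists f' : HomC L N, forall x, i (f' x) = f x.
Proof.
move=> iI fi; have /choice[f' f'E] : forall x, exists y, i y = f x.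
  by move=> x; have [y _ yx] := fi x; exists y.
have lf : linear f' by move=> a x y; apply: iI; rewrite linearP /= !f'E linearP.
have af (phi : dual C) x : f' (act phi x) = act phi (f' x).
  by apply: iI; rewrite f'E -!act_hom f'E.
by exists (mkHom lf af).
Qed.

Lemma hom_desc L M Q (p : HomC L Q) (f : HomC L M) : epi p ->
  (forall x, p x = 0 -> f x = 0) -> exists f' : HomC Q M, forall x, f' (p x) = f x.
Proof.
move=> /choice[r rE] kpf.
have fE x y : p x = p y -> f x = f y.
  move=> pxy; apply/eqP; rewrite -subr_eq0 -linearB; apply/eqP/kpf.
  by rewrite linearB /= pxy subrr.
have lf : linear (fun x => f (r x)).
  move=> a x y; transitivity (f (a *: r x + r y)); last by rewrite linearP.
  by apply: fE; rewrite rE linearP /= !rE.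
have af (phi : dual C) x : f (r (act phi x)) = act phi (f (r x)).
  by rewrite act_hom; apply: fE; rewrite -act_hom !rE.
by exists (mkHom lf af) => x; rewrite mkHomE; apply: fE; rewrite rE.
Qed.

Definition act_stable M (P : set M) := forall (f : dual C) m, P m -> P (act f m).

Lemma subcomodule_act M (P : set M) : subcomodule P -> act_stable P.
Proof.
move=> [hP cP] f m /cP[t [Pt mE]]; rewrite -[act f m]/(contract f (coact M m)) mE.
rewrite linear_sum big_seq; apply: subspace_sum => // p pt.
by rewrite /= contractE; apply: subspaceZ => //; exact: Pt.
Qed.

(** When the left factors of the coaction of m admit dual forms, each right factor is [act f m] for
    one of these forms, hence lies in [P]. *)
Lemma coact_stable M (P : set M) m : act_stable P -> P m ->
  exists n (c : 'I_n -> C) (x : 'I_n -> M),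
    (forall i, P (x i)) /\ coact M m = \sum_i tmk (c i) (x i).
Proof.
move=> aP Pm; have [n [c [x [mE cf]]]] := tens_free_repr (coact M m).
exists n, c, x; split=> // i; have [f fc] := cf i.
suff <- : act f m = x i by exact: aP.
rewrite -[LHS]/(contract f (coact M m)) mE linear_sum (bigD1 i) //= contractE fc eqxx.
rewrite scale1r big1 ?addr0 // => k /negbTE ki.
by rewrite contractE fc ki scale0r.
Qed.

Lemma subcomoduleP M (P : set M) : subspace P -> act_stable P -> subcomodule P.
Proof.
move=> hP aP; split=> // m Pm; have [n [c [x [Px mE]]]] := coact_stable aP Pm.
exists [seq (c i, x i) | i <- enum 'I_n]; split.
  by move=> p /mapP[i _ ->]; exact: Px.
by rewrite mE big_map big_enum.
Qed.

Lemma subcomodule_image M N (f : HomC M N) (P : set M) :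
  subcomodule P -> subcomodule (f @` P).
Proof.
move=> cP; apply: subcomoduleP; first exact: (subspace_image f cP.1).
by move=> phi _ [x Px <-]; exists (act phi x); [exact: subcomodule_act|rewrite act_hom].
Qed.

Lemma subcomodule_preimage M N (f : HomC M N) (P : set N) :
  subcomodule P -> subcomodule (f @^-1` P).
Proof.
move=> cP; apply: subcomoduleP; first exact: (subspace_preimage f cP.1).
move=> phi x Px; rewrite /preimage /= -act_hom; exact: (subcomodule_act cP).
Qed.

Lemma subcomoduleT M : subcomodule [set: M].
Proof. by apply: subcomoduleP => //; exact: subspaceT. Qed.

Lemma subcomodule0 M : subcomodule [set 0 : M].
Proof.
apply: subcomoduleP; first exact: subspace0.
by move=> f _ ->; exact: linear0.
Qed.

Lemma subcomodule_range M N (f : HomC M N) : subcomodule (range f).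
Proof. exact: (subcomodule_image f (subcomoduleT M)). Qed.

Lemma subcomodule_ker M N (f : HomC M N) : subcomodule [set x | f x = 0].
Proof. exact: (subcomodule_preimage f (subcomodule0 N)). Qed.

(** The coaction restricts to [P] because its values come from C (x) P and the map from C (x) P to C
    (x) M is injective, as contractions show. This turns subsets such as images and simple
    subcomodules into comodules. *)
Lemma subcomodule_embed M (P : set M) : subcomodule P ->
  exists (N : comodule C s) (i : HomC N M), mono i /\ range i = P.
Proof.
move=> cP; have hP := cP.1; have aP := subcomodule_act cP.
pose v : {linear sub_space hP -> M} := val.
pose j : tens C (sub_space hP) -> tens C M := tmap idfun v.
have jI : injective j.
  move=> t u tu; apply: tens_eq => f; apply: val_inj.
  by rewrite -[LHS](contract_tmap v) -[RHS](contract_tmap v) -/(j t) tu.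
have /choice[rho rhoE] : forall x : sub_space hP, exists t, j t = coact M (v x).
  move=> x; have [n [c [y [Py xE]]]] := coact_stable aP (asboolW (sub_valP x)).
  exists (\sum_i tmk (c i) (in_sub hP (Py i))).
  by rewrite /j linear_sum xE; apply: eq_bigr => i _; rewrite /= tmapE.
have lrho : linear rho.
  have jl a t u : j (a *: t + u) = a *: j t + j u by rewrite /j linearP.
  by move=> a x y; apply: jI; rewrite jl !rhoE (linearP v) linearP.
have vE f x : v (contract f (rho x)) = act f (v x).
  by rewrite -contract_tmap -/(j _) rhoE.
pose rho' := to_linear lrho.
have r1 m : contract (conv1 C) (rho' m) = m by apply: val_inj; rewrite [LHS]vE act1.
have rM f g m : contract (conv s f g) (rho' m) = contract g (rho' (contract f (rho' m))).
  by apply: val_inj; rewrite [LHS]vE [RHS]vE [v _ in RHS]vE actM.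
pose N := build_comodule r1 rM.
pose i : HomC N M := @mkHom N M (v : N -> M) (linearP v) vE.
exists N, i; split; first by move=> x y /val_inj.
apply/seteqP; split=> [_ [x _ <-]|x Px]; first exact: (asboolW (sub_valP x)).
by exists (in_sub hP Px).
Qed.

(** The map [g] need not be mono: [f] descends to the image of [g], and from there it extends by
    injectivity. *)
Lemma injective_extend M N E (g : HomC M N) (f : HomC M E) : injective_comod E ->
  (forall x, g x = 0 -> f x = 0) -> exists f' : HomC N E, forall x, f' (g x) = f x.
Proof.
move=> iE gf; have [G [i [iI iG]]] := subcomodule_embed (subcomodule_range g).
have [p pE] : exists p : HomC M G, forall x, i (p x) = g x.
  by apply: hom_lift => // x; rewrite iG; exists x.
have ep : epi p.
  move=> y; have [x _ xy] : range g (i y) by rewrite -iG; exists y.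
  by exists x; apply: iI; rewrite pE.
have [|h hE] := hom_desc (p := p) (f := f) ep.
  by move=> x px; apply: gf; rewrite -pE px linear0.
have [f' f'E] := iE G N i h iI.
by exists f' => x; rewrite -pE f'E hE.
Qed.

Lemma isomorphic_sym M N : isomorphic M N -> isomorphic N M.
Proof.
move=> [f [fI fS]]; have [|g gE] := hom_lift (f := idC N) fI.
  by move=> x; have [y yx] := fS x; exists y.
exists g; split=> [x y xy|x]; first by rewrite -[x]gE xy gE.
by exists (f x); apply: fI; rewrite gE.
Qed.

(** Every [act f m] lies in the span of the finitely many right factors of the coaction of m. *)
Lemma findim_cyclic M (m : M) : findim (range (fun f : dual C => act f m)).
Proof.
have [n [c [x mE]]] := tens_sum_ord (coact M m).
pose F := to_linear ((act_bilin M).1 m).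
have [k _ kE] : exists2 k, (k <= n)%N & has_dim (range F) k.
  apply: (has_dim_bounded (subspace_range F)) => k y Fy fy.
  apply: (lfree_leq fy (y := x)) => i; have [f _ <-] := Fy i.
  rewrite -[F f]/(contract f (coact M m)) mE linear_sum; exists (fun i => dual_fun f (c i)).
  by apply: eq_bigr => l _; rewrite /= contractE.
by exists k.
Qed.

(* Comodules are locally finite, so a nonzero subcomodule of least finite dimension
   exists, and it is simple. *)
Lemma simple_sub_exists M (P : set M) x : subcomodule P -> P x -> x <> 0 ->
  exists Q : set M, simple_sub Q /\ Q `<=` P.
Proof.
move=> cP Px x0.
pose D n := `[< exists Q : set M, [/\ subcomodule Q, Q `<=` P, Q <> [set 0] & has_dim Q n] >].
have exD : exists n, D n.
  have [n Zn] := findim_cyclic x; exists n; apply/asboolP.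
  exists (range (fun f : dual C => act f x)); split=> //.
  - apply: subcomoduleP; first exact: (subspace_range (to_linear ((act_bilin M).1 x))).
    by move=> f _ [g _ <-]; exists (conv s g f) => //; rewrite actM.
  - by move=> _ [f _ <-]; exact: subcomodule_act.
  - move=> Z0; apply: x0; have : [set 0] x by rewrite -Z0; exists (conv1 C); rewrite ?act1.
    by [].
case: (ex_minnP exD) => n /asboolP[Q [cQ QP Q0 Qn]] minn.
exists Q; split=> //; split=> //; split=> // R cR RQ.
have [|R0] := pselect (R = [set 0]); [by left|right].
have [m mn Rm] := has_dim_sub cQ.1 cR.1 RQ Qn.
have nm : (n <= m)%N.
  by apply: minn; apply/asboolP; exists R; split=> // y /RQ; exact: QP.
apply: (has_dim_sub_eq cQ.1 cR.1 RQ Qn).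
by rewrite (_ : n = m) //; apply/eqP; rewrite eqn_leq nm.
Qed.

Lemma simple_sub_simple M N (i : HomC N M) : mono i -> simple_sub (range i) -> simple N.
Proof.
move=> iI [cQ [Q0 sQ]]; split=> [zN|P cP].
  apply: Q0; apply/seteqP; split=> [_ [x _ <-]|_ ->]; first by rewrite (zN x) linear0.
  by exists 0; rewrite ?linear0.
have [|E|E] := sQ (i @` P) (subcomodule_image i cP).
- by move=> _ [x Px <-]; exists x.
- left; apply/seteqP; split=> [x Px|_ ->]; last exact: cP.1.1.
  by apply: (mono0 iI); have : (i @` P) (i x) by [exists x]; rewrite E.
- right; apply/seteqP; split=> // x _.
  have : range i (i x) by exists x.
  by rewrite -E => -[y Py /iI <-].
Qed.

Lemma essential_mono M N L (u : HomC M N) (f : HomC N L) :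
  essential (range u) -> (forall x, f (u x) = 0 -> u x = 0) -> mono f.
Proof.
move=> eu h; apply: mono_ker => x fx; apply: (eu [set x | f x = 0]) => //.
  exact: subcomodule_ker.
by move=> _ [[y _ <-]] /h.
Qed.

End Homs.

(** * Socle-finite injective comodules *)

Section IdempotentStep.
Variables (K : fieldType) (V V1 : lmodType K).
Variables (pi pi' : {linear V -> V}) (A : {linear V1 -> V}) (P : {linear V -> V1}).
Variables (Z : set V) (Z1 : set V1).

Lemma subspace_fixed (q : {linear V -> V}) : subspace Z -> subspace [set z | Z z /\ q z = z].
Proof.
move=> hZ; split=> [|a x y [Zx qx] [Zy qy]]; first by split; [exact: hZ.1|exact: linear0].
by split; [exact: hZ.2|rewrite linearP /= qx qy].
Qed.

(** On the fixed space of [pi'] the map [P] has the fixed space of [pi] as kernel and [Z1] as image.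
    It serves both for the part of a comodule cut out by a form and for a space of homomorphisms. *)
Lemma has_dim_fixed_step a b : subspace Z ->
  (forall z, pi' z = pi z + A (P z)) -> (forall x, P (A x) = x) ->
  (forall x, pi (A x) = 0) -> (forall z, P (pi z) = 0) ->
  (forall x, Z1 x -> Z (A x)) -> (forall z, Z z -> Z1 (P z)) ->
  has_dim [set z | Z z /\ pi z = z] a -> has_dim Z1 b ->
  has_dim [set z | Z z /\ pi' z = z] (a + b).
Proof.
move=> hZ pi'E PA piA Ppi AZ PZ Za Z1b.
apply: (has_dim_ker_image (f := P)); first exact: subspace_fixed.
  suff <- : [set z | Z z /\ pi z = z] =
    [set z | Z z /\ pi' z = z] `&` [set x | P x = 0] by [].
  apply/seteqP; split=> [z [Zz piz]|z [[Zz pi'z] Pz]].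
    have Pz : P z = 0 by rewrite -piz Ppi.
    by split=> //; split=> //; rewrite pi'E Pz linear0 addr0.
  by split=> //; rewrite -[RHS]pi'z pi'E Pz linear0 addr0.
suff -> : P @` [set z | Z z /\ pi' z = z] = Z1 by [].
apply/seteqP; split=> [_ [z [Zz _] <-]|x Z1x]; first exact: PZ.
exists (A x) => //; split; first exact: AZ.
by rewrite pi'E piA PA add0r.
Qed.

End IdempotentStep.

(** * The regular comodule *)

Section Regular.
Variables (K : fieldType) (C : coalgebra K) (s : side).

Definition cact t (f : dual C) (c : C) : C := @act K C t (regular C t) f c.

Lemma conv_cact t (f g : dual C) c : conv t f g c = g (cact t f c).
Proof.
have l1 : linear (fun u : tens C C => tlift (fun a b => f a * g b : K^o) u).
  exact: (tlift_linear (conv_bilin f g)).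
have l2 : linear (fun u : tens C C => g (contract f u) : K^o).
  by move=> a x y; rewrite linearP dual_linear.
apply: (tens_lin_ext l1 l2 _ (comult_at C t c)) => a b.
by rewrite (tlift_mk _ _ (conv_bilin f g)) contractE dualZ.
Qed.

Lemma counit_cact t (f : dual C) c : counit C (cact t f c) = f c.
Proof.
transitivity (conv t f (conv1 C) c); first by rewrite conv_cact.
by rewrite -conv_opp conv_cact /cact act1.
Qed.

Lemma cact_swap t (f g : dual C) c : f (cact (opp_side t) g c) = g (cact t f c).
Proof. by rewrite -!conv_cact conv_opp. Qed.

Lemma cactC (f g : dual C) c :
  cact s f (cact (opp_side s) g c) = cact (opp_side s) g (cact s f c).
Proof. exact: act_regularC. Qed.

(** The isomorphism of Hom_C(M, C) with the dual of M: k x is the sum of phi(x_(0)) x_(-1), and the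
    counit of k x returns phi x. *)
Lemma form_hom (M : comodule C s) (phi : dual M) :
  exists k : HomC M (regular C s), forall (f : dual C) x, f (k x : C) = phi (act f x).
Proof.
have hb : bilin (fun (c : C) (n : M) => phi n *: c).
  split=> [n a x y|c a x y]; last by rewrite dual_linear scalerDl scalerA.
  by rewrite scalerDr !scalerA mulrC.
pose k (x : M) : C := tlift (fun c n => phi n *: c) (coact M x).
have kE (f : dual C) x : f (k x) = phi (act f x).
  rewrite /k /act; move: (coact M x) => t.
  have l1 : linear (fun t : tens C M => f (tlift (fun c n => phi n *: c) t) : K^o).
    by move=> a y z; rewrite (tlift_linear hb) dual_linear.
  have l2 : linear (fun t : tens C M => phi (contract f t) : K^o).
    by move=> a y z; rewrite linearP dual_linear.
  apply: (tens_lin_ext l1 l2) => c n.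
  by rewrite (tlift_mk _ _ hb) contractE !dualZ mulrC.
have dual_inj (x y : C) : (forall f : dual C, f x = f y) -> x = y.
  move=> h; apply/eqP; rewrite -subr_eq0; apply/eqP/dual_separates0 => f.
  by rewrite dualB h subrr.
have lk : linear (k : M -> regular C s).
  by move=> a x y; rewrite /k linearP (tlift_linear hb).
have ak (f : dual C) x : (k (act f x) : regular C s) = act f (k x : regular C s).
  apply: dual_inj => g; rewrite kE -actM -kE.
  exact: conv_cact.
by exists (mkHom lk ak) => f x; rewrite mkHomE kE.
Qed.

End Regular.

(* On the left [ib_u j] identifies [E j] with [e_j C], on the right with [C e_j]. *)
Record injective_basis (K : fieldType) (C : coalgebra K) (s : side) (I : Type) :=
  InjectiveBasis {
  ib_S : I -> comodule C s;
  ib_E : I -> comodule C s;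
  ib_env : forall j, HomC (ib_S j) (ib_E j);
  ib_e : I -> dual C;
  ib_u : forall j, HomC (ib_E j) (regular C s);
  ib_simple : forall j, simple (ib_S j);
  ib_cover : forall T : comodule C s, simple T -> exists j, isomorphic T (ib_S j);
  ib_envP : forall j, injective_envelope (ib_env j);
  ib_idem : forall j, conv s (ib_e j) (ib_e j) = ib_e j;
  ib_mono : forall j, mono (ib_u j);
  ib_range : forall j, range (ib_u j : ib_E j -> C) = range (cact (opp_side s) (ib_e j))
}.

Section InjectiveBasis.
Variables (K : fieldType) (C : coalgebra K) (s : side) (I : Type).
Variable B : injective_basis C s I.
Implicit Types L M E : comodule C s.

Lemma range_actP j M (x : M) : range (act (ib_e B j)) x <-> act (ib_e B j) x = x.
Proof.
split=> [[y _ <-]|xE]; last by exists x.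
by rewrite -actM ib_idem.
Qed.

Lemma subspace_act M (f : dual C) : subspace (range (act f : M -> M)).
Proof. exact: (subspace_range (@act K C s M f)). Qed.

Lemma ib_uE j (x : ib_E B j) : cact (opp_side s) (ib_e B j) (ib_u B j x) = ib_u B j x.
Proof.
have : range (ib_u B j : ib_E B j -> C) (ib_u B j x) by exists x.
rewrite ib_range => -[c _ <-]; rewrite /cact -actM.
by rewrite conv_opp ib_idem.
Qed.

Lemma ib_factor M j (k : HomC M (regular C s)) :
  (forall x, cact (opp_side s) (ib_e B j) (k x) = k x) ->
  exists m : HomC M (ib_E B j), forall x, ib_u B j (m x) = k x.
Proof.
move=> kE; apply: hom_lift; first exact: ib_mono.
move=> x; have : range (cact (opp_side s) (ib_e B j)) (k x : C) by exists (k x : C).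
by rewrite -ib_range.
Qed.

Section HomPairing.
Variables (M : comodule C s) (j : I).

(** A map from M to C corresponds to the form counit o k on M, and the maps into [ib_E B j]
    correspond to the forms invariant under e_j; the pairing evaluates this form at x. *)
Definition hom_pairing (x : M) (m : HomC M (ib_E B j)) : K^o := counit C (ib_u B j (m x)).

Lemma hom_pairing_bilin : bilin hom_pairing.
Proof.
by split=> [m a x y|x a m n]; rewrite /hom_pairing ?homPE !linearP.
Qed.

Lemma hom_pairing_faithfull x : range (act (ib_e B j)) x ->
  (forall m, hom_pairing x m = 0) -> x = 0.
Proof.
move=> /range_actP xE h; apply: dual_separates0 => phi.
(* Replacing phi by phi o e_j does not change its value at x and makes the associated map to C
   factor through [ib_E B j]. *)
have [k kE] := form_hom (dual_act (ib_e B j) phi).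
have [|m mE] := @ib_factor M j k.
  move=> z; apply/eqP; rewrite -subr_eq0; apply/eqP/dual_separates0 => f.
  rewrite dualB cact_swap; apply/eqP; rewrite subr_eq0; apply/eqP.
  rewrite -[cact s f (k z)]/(act f (k z)) act_hom !kE.
  rewrite -[LHS]/(dual_fun phi (act _ _)) -[RHS]/(dual_fun phi (act _ _)).
  by rewrite -[in LHS]actM ib_idem.
rewrite -[x]xE -[LHS]/(dual_act (ib_e B j) phi x) -[x]act1 -kE -mE.
exact: (h m).
Qed.

Lemma hom_pairing_faithfulr m :
  (forall x, range (act (ib_e B j)) x -> hom_pairing x m = 0) -> m = 0.
Proof.
move=> h; apply: hom_eq => x; rewrite hom0E; apply: (mono0 (@ib_mono _ _ _ _ B j)).
apply: dual_separates0 => f; rewrite -ib_uE cact_swap -(counit_cact s).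
rewrite /cact !act_hom; apply: h.
by exists (act f x).
Qed.

Lemma dim_hom_act n :
  has_dim [set: HomC M (ib_E B j)] n <-> has_dim (range (act (ib_e B j) : M -> M)) n.
Proof.
have hb := hom_pairing_bilin; have h1 := subspace_act M (ib_e B j).
split=> h.
  apply: (pairing_dim hb h1 (@subspaceT _ _)) h => [x Px hx|m _ hm].
    by apply: hom_pairing_faithfull => // m; exact: hx.
  exact: hom_pairing_faithfulr.
apply: (pairing_dim (bilinC hb) (@subspaceT _ _) h1) h => [m _ hm|x Px hx].
  exact: hom_pairing_faithfulr.
by apply: hom_pairing_faithfull => // m; exact: hx.
Qed.

End HomPairing.

Section Postcomp.
Variables (L M N : comodule C s) (g : HomC M N).
Definition postcomp (m : HomC L M) : HomC L N := compC g m.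
Lemma postcomp_linear : linear postcomp.
Proof. by move=> a m n; apply: hom_eq => x; rewrite !(homPE, compCE) linearP. Qed.
HB.instance Definition _ := GRing.isLinear.Build K _ _ _ postcomp postcomp_linear.
End Postcomp.

(* [pi] is the projection of [E] onto a summand isomorphic to the direct sum of the
   [E j], for [j] in the list. *)
Inductive summand E : HomC E E -> seq I -> Prop :=
| summand_nil : summand 0 [::]
| summand_cons pi ks j (a : HomC (ib_E B j) E) (p : HomC E (ib_E B j)) (pi' : HomC E E) :
    summand pi ks -> (forall x, p (a x) = x) -> (forall x, pi (a x) = 0) ->
    (forall x, p (pi x) = 0) -> (forall x, pi' x = pi x + a (p x)) ->
    summand pi' (j :: ks).

Lemma summand_idem E (pi : HomC E E) ks : summand pi ks -> forall x, pi (pi x) = pi x.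
Proof.
elim=> [x|{}pi {}ks j a p pi' _ IH pa pia ppi pi'E x]; first by rewrite hom0E.
by rewrite !pi'E linearD /= IH pia addr0 linearD /= ppi pa add0r.
Qed.

Lemma summand_dim_act E (pi : HomC E E) ks (f : dual C) (c : I -> nat) :
  (forall j, has_dim (range (act f : ib_E B j -> ib_E B j)) (c j)) -> summand pi ks ->
  has_dim [set x | range (act f) x /\ pi x = x] (\sum_(k <- ks) c k).
Proof.
move=> hc; elim=> [|{}pi {}ks j a p pi' _ IH pa pia ppi pi'E].
  rewrite big_nil (_ : mkset _ = [set 0]); first exact: has_dim0.
  apply/seteqP; split=> [x [_ <-]|_ ->]; first exact: hom0E.
  by split; [exact: (subspace_act E f).1|exact: hom0E].
rewrite big_cons addnC.
apply: (has_dim_fixed_step (subspace_act E f) pi'E pa pia ppi) IH (hc j).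
  by move=> _ [x _ <-]; exists (a x) => //; rewrite act_hom.
by move=> _ [x _ <-]; exists (p x) => //; rewrite act_hom.
Qed.

Lemma summand_dim_hom L E (pi : HomC E E) ks (c : I -> nat) :
  (forall j, has_dim [set: HomC L (ib_E B j)] (c j)) -> summand pi ks ->
  has_dim [set m : HomC L E | setT m /\ postcomp pi m = m] (\sum_(k <- ks) c k).
Proof.
move=> hc; elim=> [|{}pi {}ks j a p pi' _ IH pa pia ppi pi'E].
  rewrite big_nil (_ : mkset _ = [set 0]); first exact: has_dim0.
  apply/seteqP; split=> [m [_ <-]|_ ->]; first by apply: hom_eq => x; rewrite compCE hom0E.
  by split=> //; exact: linear0.
rewrite big_cons addnC.
apply: (has_dim_fixed_step (A := @postcomp L _ _ a) (P := @postcomp L _ _ p) (@subspaceT _ _))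
  IH (hc j) => // m; apply: hom_eq => x; rewrite ?homDE !compCE ?hom0E //.
Qed.

Lemma subspace_socle M : subspace (@socle K C s M).
Proof.
split=> [|a x y hx hy] A [sA GA]; first exact: sA.1.
by apply: sA.2; [exact: hx|exact: hy].
Qed.

(** A simple subcomodule of the kernel of [pi] is a copy of some S(j), and its envelope splits off
    inside that kernel. The vector v is a socle vector that the new projection gains; it is what
    makes the enlargement countable. *)
Lemma summand_extend E (pi : HomC E E) ks x : injective_comod E -> summand pi ks ->
  pi x <> x -> exists j (pi' : HomC E E) v,
    [/\ summand pi' (j :: ks), socle v, v <> 0 /\ pi v = 0, pi' v = v
      & forall y, pi y = y -> pi' y = y].
Proof.
move=> iE pik pix; have idem := summand_idem pik.
have [Q [sQ Qpi]] : exists Q, simple_sub Q /\ Q `<=` [set x | pi x = 0].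
  apply: (@simple_sub_exists _ _ _ _ _ (x - pi x) (subcomodule_ker pi)).
    by rewrite /= linearB /= idem subrr.
  by move=> /eqP; rewrite subr_eq0 eq_sym => /eqP.
have [N [i [iI iQ]]] := subcomodule_embed sQ.1.
have [j /isomorphic_sym[f [fI fS]]] : exists j, isomorphic N (ib_S B j).
  by apply: ib_cover; apply: (simple_sub_simple iI); rewrite iQ.
have sigpi y : pi (i (f y)) = 0 by apply: Qpi; rewrite -iQ; exists (f y).
have [envI Ej ess] := ib_envP B j.
have [a0 a0E] := iE _ _ (ib_env B j) (compC i f) envI.
(* Subtracting [pi] moves the image into the kernel of [pi] and leaves the map unchanged on S(j),
   whose image is already there. *)
pose a : HomC (ib_E B j) E := compC (idC E - pi) a0.
have aE y : a y = a0 y - pi (a0 y) by [].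
have aenv y : a (ib_env B j y) = i (f y) by rewrite aE a0E compCE sigpi subr0.
have aI : mono a.
  apply: (essential_mono ess) => y; rewrite aenv => /(mono0 iI)/(mono0 fI) ->.
  exact: linear0.
have pia y : pi (a y) = 0 by rewrite aE linearB /= idem subrr.
have [p0 p0E] := Ej _ _ a (idC _) aI.
(* Precomposition with 1 - pi makes the retraction vanish on the image of [pi], so that the two
   summands are complementary. *)
pose p : HomC E (ib_E B j) := compC p0 (idC E - pi).
have pE y : p y = p0 (y - pi y) by [].
have pa y : p (a y) = y by rewrite pE pia subr0 p0E.
have ppi y : p (pi y) = 0 by rewrite pE idem subrr linear0.
pose pi' : HomC E E := pi + compC a p.
have pi'E y : pi' y = pi y + a (p y) by [].
have [y0 y00] : exists y : ib_S B j, y <> 0.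
  have [nz _] := ib_simple B j; apply: contrapT => h; apply: nz => y.
  by apply: contrapT => y0; apply: h; exists y.
exists j, pi', (i (f y0)); split.
- exact: (summand_cons pik pa pia ppi pi'E).
- by move=> A [_ GA]; apply: GA; exists Q => //; rewrite -iQ; exists (f y0).
- by split=> // /(mono0 iI)/(mono0 fI).
- by rewrite pi'E sigpi add0r -aenv pa.
- by move=> y piy; rewrite pi'E -{2}piy ppi linear0 addr0.
Qed.

(** The socle bounds the process: [Q m] asks for m independent socle vectors fixed by a summand
    projection. For the largest such m the projection is the identity, since otherwise one more
    summand would bring one more vector. *)
Lemma injective_summands E : Cinj E ->
  exists ks (pi : HomC E E), summand pi ks /\ forall x, pi x = x.
Proof.
move=> [iE [n socn]].
pose Q m := `[< exists ks (pi : HomC E E) (x : 'I_m -> E),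
  [/\ summand pi ks, lfree x, forall i, socle (x i) & forall i, pi (x i) = x i] >].
have exQ : exists m, Q m.
  exists 0%N; apply/asboolP; exists [::], 0, (fun=> 0).
  by split; [exact: summand_nil|move=> ? _ []|case|case].
have bQ m : Q m -> (m <= n)%N.
  move=> /asboolP[ks [pi [x [_ fx sx _]]]].
  have [y [_ _ sy]] := (has_dimP _ (subspace_socle E)).1 socn.
  exact: (lfree_leq fx (fun i => sy _ (sx i))).
case: (ex_maxnP exQ bQ) => m /asboolP[ks [pi [x [pik fx sx pix]]]] maxm.
exists ks, pi; split=> // z; apply: contrapT => piz.
have [j [pi' [v [pi'k sv [v0 piv] pi'v pi'x]]]] := summand_extend iE pik piz.
suff /maxm : Q m.+1 by rewrite ltnn.
apply/asboolP; exists (j :: ks), pi', (lcons v x); split=> //.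
(* The projection [pi] fixes every x i and kills v, so a combination v of the x i would equal pi v =
   0. *)
- apply: lfree_cons => // -[c vE]; apply: v0; rewrite -piv {1}vE [in RHS]vE linear_sumZ.
  by apply: eq_bigr => i _; rewrite /= pix.
- by move=> i; case: (unliftP ord0 i) => [k ->|->]; rewrite ?lconsS ?lcons0.
- by move=> i; case: (unliftP ord0 i) => [k ->|->]; rewrite ?lconsS ?lcons0 //; exact/pi'x.
Qed.

End InjectiveBasis.

(** * Comodules of injective dimension one *)

Section InjectiveDimensionOne.
Variables (K : fieldType) (C : coalgebra K) (s : side).

(* As in Schanuel's lemma for the copresentation and a resolution of length 1, the inclusion of [range g] in
   [E1] is split, hence onto because it is essential. *)
Lemma inj_dim1_epi (M E0 E1 : comodule C s) (u : HomC M E0) (g : HomC E0 E1) :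
  minimal_copresentation u g -> inj_dim M 1 -> epi g.
Proof.
move=> [[iE0 _] [iE1 _] [uI ug] _ ess] [[R lR] _].
pose aug := ir_aug R; pose d := ir_diff R 0%N.
have [iR0 iR1] := (@ir_inj _ _ _ _ R 0%N, @ir_inj _ _ _ _ R 1%N).
have dS : epi d.
  by move=> y; apply/(@ir_exact _ _ _ _ R 0%N y); exact: (lR 2%N).
have gu m : g (u m) = 0 by apply/ug; exists m.
have daug m : d (aug m) = 0 by apply/(@ir_exact0 _ _ _ _ R); exists m.
have [a aE] := iE0 _ _ aug u (@ir_mono _ _ _ _ R).
have [b bE] := iR0 _ _ u aug uI.
have [|be beE] := injective_extend (g := g) (f := compC d b) iR1.
  by move=> x /ug[m <-]; rewrite compCE bE daug.
have [|al alE] := hom_desc (p := d) (f := compC g a) dS.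
  by move=> x /(@ir_exact0 _ _ _ _ R)[m <-]; rewrite compCE aE gu.
(* The comparison maps [a] and [b] agree with the augmentations on M, so 1 - ab vanishes on the
   image of [u] and factors through [g]. *)
have [|ps psE] := injective_extend (g := g) (f := idC E0 - compC a b) iE0.
  by move=> x /ug[m <-]; rewrite homBE compCE bE aE subrr.
(* Since al o be o g = g o a o b, adding g o ps restores g: [r] is the identity on the image of [g].
   It takes values in that image because [d] is onto and al o d = g o a. *)
pose r : HomC E1 E1 := compC al be + compC g ps.
have rg x : r (g x) = g x.
  rewrite homDE !compCE beE psE homBE !compCE alE compCE linearB /=.
  by rewrite addrC subrK.
have rS y : exists x, g x = r y.
  have [z zE] := dS (be y); exists (a z + ps y).
  by rewrite homDE !compCE -zE alE linearD.
have ker0 : [set y | r y = 0] `<=` [set 0].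
  apply: ess; first exact: subcomodule_ker.
  by move=> _ [[x _ <-] h]; rewrite -(rg x); exact: h.
move=> y; have [x xE] := rS y; exists x; rewrite xE.
apply/eqP; rewrite -subr_eq0; apply/eqP/ker0.
have rr : r (r y) = r y by rewrite -xE rg.
by change (r (r y - y) = 0); rewrite homB rr subrr.
Qed.

End InjectiveDimensionOne.

(** * The transpose *)

Section Nabla.
Variables (K : fieldType) (C : coalgebra K).

(** Induction on the finite list of points that controls [L]. If some phi0 vanishes on [r] and is 1
    at v, subtracting from [L] the evaluation at L(phi0) v leaves a form controlled by [r]; if there
    is none, [r] controls [L] already. *)
Lemma continuous_form_eval (V : lmodType K) (L : dual V -> K^o) (r : seq V) : linear L ->
  (forall phi : dual V, (forall v, v \in r -> phi v = 0) -> L phi = 0) ->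
  exists v, forall phi, L phi = phi v.
Proof.
elim: r L => [|v r IH] L lL hL; first by exists 0 => phi; rewrite dual0; exact: hL.
have [[phi0 [phi0r phi0v]]|none] :=
  pselect (exists phi : dual V, (forall w, w \in r -> phi w = 0) /\ phi v = 1); last first.
  apply: IH => // phi phir; apply: hL => w; rewrite inE => /orP[/eqP ->|]; last exact: phir.
  apply: contrapT => /eqP phiv; apply: none; exists ((phi v)^-1 *: phi + 0).
  split=> [z zr|]; rewrite dual_addE addr0; first by rewrite (phir z zr) mulr0.
  by rewrite mulVf.
have lL' : linear (fun phi : dual V => L phi - phi v * L phi0 : K^o).
  move=> a phi psi; rewrite lL dual_addE mulrDl opprD addrACA -mulrA.
  by rewrite scalerBr.
have [|w wE] := IH _ lL'; last first.
  exists (w + L phi0 *: v) => phi.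
  by rewrite dualD dualZ -wE mulrC subrK.
move=> phi phir; have : L (- phi v *: phi0 + phi) = 0.
  apply: hL => z; rewrite inE dual_addE => /orP[/eqP ->|zr].
    by rewrite phi0v mulr1 addNr.
  by rewrite phi0r // (phir z zr) mulr0 addr0.
by rewrite lL addrC scaleNr.
Qed.

Variable s : side.
Implicit Types E M : comodule C s.

Lemma hstar_eq E (h h' : hstar E) : (forall phi c, h phi c = h' phi c) -> h = h'.
Proof. by move=> e; apply/val_inj/funext => phi; apply: dual_ext => c; exact: e. Qed.

Lemma chomPE t (X Y : tmodule C t) a (h h' : chom X Y) x :
  (a *: h + h' : chom X Y) x = a *: h x + h' x.
Proof. by []. Qed.

Lemma hstarPE E a (h h' : hstar E) phi c :
  (a *: h + h' : hstar E) phi c = a * h phi c + h' phi c.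
Proof.
rewrite -[_ phi]/(chom_fun (a *: h + h' : chom _ _) phi) chomPE.
exact: erefl.
Qed.

Section HstarOf.
Variables (E : comodule C s) (k : HomC (regular C s) E).

Fact hstar_of_proof :
  let h := fun phi : dualmod E => dual_map k phi : Cstar_mod C s in
  [/\ linear h, forall f phi, h (tm_act f phi) = tm_act f (h phi) & tcontinuous h].
Proof.
split.
- by move=> a phi psi; apply: dual_ext.
- move=> f phi; apply: dual_ext => c.
  rewrite -[LHS]/(dual_fun phi (act f (k c))) act_hom.
  by [].
move=> _ [r ->]; exists [set phi | forall m, m \in [seq k c | c <- r] -> dual_fun phi m = 0].
split; first by exists [seq k c | c <- r].
by move=> phi h c cr; apply: h; apply: map_f.
Qed.

Definition hstar_of : hstar E := in_sub _ hstar_of_proof.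

Lemma hstar_ofE phi c : hstar_of phi c = dual_fun phi (k c).
Proof. by []. Qed.

End HstarOf.

(** For each c the form phi |-> h phi c is continuous on the dual of E, hence the evaluation at a
    vector k c, and k commutes with the action because h does. Continuous homomorphisms from the
    dual of E to that of C are therefore the same as comodule maps from C to E. *)
Lemma hstar_of_exists E (h : hstar E) : exists k, h = hstar_of k.
Proof.
have /asboolP [lh eh ch] := sub_valP h.
have /choice[k kE] : forall c : C, exists x : E, forall phi : dual E, h phi c = phi x.
  move=> c; have [|W [[r ->] hW]] := ch [set psi | forall m, m \in [:: c] -> dual_fun psi m = 0].
    by exists [:: c].
  apply: (@continuous_form_eval _ (fun phi => h phi c) r) => [a phi psi|phi phir].
    by rewrite /hstar_fun lh.
  by apply: (hW phi phir); rewrite inE.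
have dual_inj (x y : E) : (forall f : dual E, f x = f y) -> x = y.
  move=> e; apply/eqP; rewrite -subr_eq0; apply/eqP/dual_separates0 => f.
  by rewrite dualB e subrr.
have lk : linear (k : regular C s -> E).
  by move=> a x y; apply: dual_inj => f; rewrite dual_linear -!kE dual_linear.
have ak (f : dual C) (c : regular C s) : k (act f c) = act f (k c).
  apply: dual_inj => phi; rewrite -kE.
  transitivity (h (dual_act f phi) c); last by rewrite kE.
  by rewrite /hstar_fun (eh f phi).
by exists (mkHom lk ak); apply: hstar_eq => phi c; rewrite hstar_ofE kE.
Qed.

Section Pairing.
Variables (I : Type) (B : injective_basis C s I) (j : I).

(** Multiplication by e_j on the opposite side commutes with the action on side [s], so it is a
    comodule map that projects C onto its summand [ib_E B j]. *)
Lemma ib_projection : exists q : HomC (regular C s) (ib_E B j),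
  forall c, ib_u B j (q c) = cact (opp_side s) (ib_e B j) c.
Proof.
have lk : linear (cact (opp_side s) (ib_e B j) : regular C s -> regular C s).
  exact: (act_linear (M := regular C (opp_side s))).
have ak (f : dual C) (c : regular C s) :
    (cact (opp_side s) (ib_e B j) (act f c) : regular C s) =
    act f (cact (opp_side s) (ib_e B j) c : regular C s).
  exact: (esym (cactC s f (ib_e B j) c)).
have [|q qE] := @ib_factor _ _ _ _ B _ j (mkHom lk ak); last by exists q.
by move=> c; rewrite mkHomE /cact -actM conv_opp ib_idem.
Qed.

Variable q : HomC (regular C s) (ib_E B j).
Hypothesis qE : forall c, ib_u B j (q c) = cact (opp_side s) (ib_e B j) c.

Lemma ib_projectionK x : q (ib_u B j x) = x.
Proof. by apply: (@ib_mono _ _ _ _ B j); rewrite qE ib_uE. Qed.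

Section OneNabla.
Variables (E : comodule C s) (N : comodule C (opp_side s)) (th : N -> dual (hstar E)).
Hypothesis thP : is_nabla th.

(** A form on Hom_C(C, E) is restricted to the maps that factor through the projection [q]; on the
    e_j part of nabla E this restriction loses nothing. *)
Definition nabla_pairing (x : N) (m : HomC (ib_E B j) E) : K^o :=
  th x (hstar_of (compC m q)).

Lemma nabla_pairing_bilin : bilin nabla_pairing.
Proof.
have [lth _ _ _] := thP; split=> [m a x y|x a m n]; rewrite /nabla_pairing.
  by rewrite lth dual_addE.
rewrite (_ : hstar_of (compC (a *: m + n) q) =
  a *: hstar_of (compC m q) + hstar_of (compC n q)); first by rewrite dual_linear.
by apply: hstar_eq => phi c; rewrite hstar_ofE compCE homPE dual_linear.
Qed.

Lemma nabla_pairing_faithfull x : act (ib_e B j) x = x ->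
  (forall m, nabla_pairing x m = 0) -> x = 0.
Proof.
have [lth thI _ thA] := thP => xE hx; apply: thI.
have -> : th 0 = 0 by exact: (linear0 (to_linear lth)).
apply: dual_ext => h.
(* As e_j x = x, the form [th x] sees k only through k o e_j, which is (k o u_j) o q. *)
rewrite -[x]xE thA; have [k ->] := hstar_of_exists h.
rewrite -[RHS](hx (compC k (ib_u B j))) /nabla_pairing; congr (dual_fun (th x) _).
apply: hstar_eq => phi c.
by rewrite hstar_ofE !compCE qE.
Qed.

Lemma nabla_pairing_faithfulr m :
  (forall x, act (ib_e B j) x = x -> nabla_pairing x m = 0) -> m = 0.
Proof.
have [lth _ thS thA] := thP => hm; apply: hom_eq => y; rewrite hom0E.
apply: dual_separates0 => phi.
(* Reading h at phi and at the single element u_j y is continuous, hence comes from some x in N. The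
   e_j part of x then pairs with m to phi (m y). *)
have lxi : linear (fun h : hstar E => h phi (ib_u B j y) : K^o).
  by move=> a h h'; rewrite hstarPE.
have /thS[x xE] : hstar_continuous (in_sub _ lxi : dual (hstar E)).
  by exists [:: ib_u B j y : C] => h h0; apply: h0; rewrite inE.
have := hm (act (ib_e B j) x); rewrite -actM conv_opp ib_idem => /(_ erefl) <-.
rewrite /nabla_pairing thA xE.
rewrite -[RHS]/(dual_fun phi (m (q (cact (opp_side s) (ib_e B j) (ib_u B j y))))).
by rewrite ib_uE ib_projectionK.
Qed.

End OneNabla.

(* [e_j Tr M] is the annihilator of [g Hom (E j, E0)] in the dual of [Hom (E j, E1)]. *)
Lemma dim_ker_nabla (E0 E1 : comodule C s) (g : HomC E0 E1)
    (N0 N1 T : comodule C (opp_side s)) (th0 : N0 -> dual (hstar E0))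
    (th1 : N1 -> dual (hstar E1)) (ng : HomC N1 N0) (k : HomC T N1) n0 n1 :
  is_nabla th0 -> is_nabla th1 -> is_nabla_map th0 th1 g ng -> mono k -> exact k ng ->
  (forall m : HomC (ib_E B j) E0, compC g m = 0 -> m = 0) ->
  has_dim [set: HomC (ib_E B j) E0] n0 -> has_dim [set: HomC (ib_E B j) E1] n1 ->
  exists2 n, (n + n0)%N = n1 & has_dim (range (act (ib_e B j) : T -> T)) n.
Proof.
move=> th0P th1P ngE kI kng gI d0 d1.
have idem (N : comodule C (opp_side s)) (x : N) :
    range (act (ib_e B j)) x <-> act (ib_e B j) x = x.
  split=> [[y _ <-]|xE]; last by exists x.
  by rewrite -actM conv_opp ib_idem.
pose G : {linear HomC (ib_E B j) E0 -> HomC (ib_E B j) E1} := postcomp g.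
have dg : has_dim (range G) n0.
  apply/(has_dim_inj _ (@subspaceT _ _)) => // m _; exact: gI.
have hP := subspace_range (@act K C _ N1 (ib_e B j)).
have hH := subspace_range G.
have hb := nabla_pairing_bilin th1P.
have fl (x : N1) : range (act (ib_e B j)) x ->
    (forall m, [set: HomC (ib_E B j) E1] m -> nabla_pairing th1 x m = 0) -> x = 0.
  by move=> /idem xE hx; apply: (nabla_pairing_faithfull th1P xE) => m; exact: hx.
have fr (m : HomC (ib_E B j) E1) : [set: HomC (ib_E B j) E1] m ->
    (forall x : N1, range (act (ib_e B j)) x -> nabla_pairing th1 x m = 0) -> m = 0.
  by move=> _ hm; apply: (nabla_pairing_faithfulr th1P) => x /idem xr; exact: hm.
have [n nE dn] := pairing_annihilator hb hP (@subspaceT _ _) hH (@subsetT _ _) fl fr d1 dg.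
exists n => //; apply/(has_dim_inj (f := k)) => [|x _|].
- exact: (subspace_range (@act K C _ T (ib_e B j))).
- exact: mono0.
(* By this adjointness, and as the pairing for E0 is faithful, the kernel of [ng] on e_j parts is
   the annihilator of the image of [G]. *)
have ngP (x : N1) m : nabla_pairing th0 (ng x) m = nabla_pairing th1 x (compC g m).
  rewrite /nabla_pairing ngE; congr (dual_fun (th1 x) _).
  by apply: hstar_eq => phi c.
suff -> : k @` range (act (ib_e B j) : T -> T) =
  [set x | range (act (ib_e B j)) x /\ forall h, range G h -> nabla_pairing th1 x h = 0].
  exact: dn.
apply/seteqP; split=> [_ [x /idem xE <-]|x [/idem xE x0]].
  have kx : ng (k x) = 0 by apply/kng; exists x.
  split=> [|_ [m _ <-]]; first by apply/idem; rewrite act_hom xE.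
  rewrite -[G m]/(compC g m) -ngP kx.
  exact: (linear0 (to_linear ((nabla_pairing_bilin th0P).1 m))).
have /kng[y yx] : ng x = 0.
  apply: (nabla_pairing_faithfull th0P); first by rewrite act_hom xE.
  by move=> m; rewrite ngP; apply: x0; exists m.
exists y => //; apply/idem; apply: kI.
by rewrite -act_hom yx xE.
Qed.

End Pairing.

(** The two orders of the indices of [c] are the row and column sums of one matrix: M is measured by
    the e_j parts of the summands of E0 and E1, and T by the maps from [ib_E B j] to these summands.
    The equations are additive because subtraction of natural numbers truncates. *)
Lemma transpose_dims (I : Type) (B : injective_basis C s I) (c : I -> I -> nat)
    (M : comodule C s) (T : comodule C (opp_side s)) :
  (forall j i, has_dim (range (act (ib_e B i) : ib_E B j -> ib_E B j)) (c j i)) ->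
  is_Tr M T -> inj_dim M 1 -> (forall h : HomC (regular C s) M, h = 0) ->
  exists ks0 ks1 : seq I, forall j,
    (exists2 n, (n + \sum_(k <- ks1) c k j)%N = (\sum_(k <- ks0) c k j)%N &
       has_dim (range (act (ib_e B j) : M -> M)) n) /\
    (exists2 n, (n + \sum_(k <- ks0) c j k)%N = (\sum_(k <- ks1) c j k)%N &
       has_dim (range (act (ib_e B j) : T -> T)) n).
Proof.
move=> cP [E0 [E1 [u [g [N0 [N1 [th0 [th1 [ng [k [cop th0P th1P ngE [kI kng]]]]]]]]]]]] M1 CM.
have gS := inj_dim1_epi cop M1.
have [iE0 iE1 [uI ug] _ _] := cop.
have [ks0 [pi0 [sum0 pi0E]]] := injective_summands B iE0.
have [ks1 [pi1 [sum1 pi1E]]] := injective_summands B iE1.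
exists ks0, ks1 => j.
have dim_act E ks (pi : HomC E E) : summand B pi ks -> (forall x, pi x = x) ->
    has_dim (range (act (ib_e B j) : E -> E)) (\sum_(k <- ks) c k j).
  move=> sumE piE; have := summand_dim_act (cP^~ j) sumE.
  by congr has_dim; apply/seteqP; split=> [x []|x].
have dim_hom E ks (pi : HomC E E) : summand B pi ks -> (forall x, pi x = x) ->
    has_dim [set: HomC (ib_E B j) E] (\sum_(k <- ks) c j k).
  (* Maps from the j-th injective to the i-th one are paired with the e_i part of the j-th one, so
     the summation index becomes the second argument of [c]. *)
  have hom_c i := (dim_hom_act B (ib_E B j) i _).2 (cP j i).
  move=> sumE piE; have := summand_dim_hom hom_c sumE.
  congr has_dim; apply/seteqP; split=> // m _; split=> //.
  by apply: hom_eq => x; rewrite compCE piE.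
split.
  have Z0 := dim_act _ _ _ sum0 pi0E; have Z1 := dim_act _ _ _ sum1 pi1E.
  have hZ0 := subspace_act E0 (ib_e B j).
  have kerE : range (act (ib_e B j)) `&` [set x | g x = 0] =
      u @` range (act (ib_e B j) : M -> M).
    apply/seteqP; split=> [x [/range_actP xE /ug[m mx]]|_ [x /range_actP xE <-]].
      by exists m => //; apply/range_actP/uI; rewrite -act_hom mx xE.
    by split; [apply/range_actP; rewrite act_hom xE|apply/ug; exists x].
  have imE : g @` range (act (ib_e B j)) = range (act (ib_e B j) : E1 -> E1).
    apply/seteqP; split=> [_ [x /range_actP xE <-]|x /range_actP xE].
      by apply/range_actP; rewrite act_hom xE.
    have [y yx] := gS x; exists (act (ib_e B j) y); first by exists y.
    by rewrite -act_hom yx xE.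
  have [n _ dn] := has_dim_sub hZ0 (subspaceI hZ0 (subspace_ker g)) (@subIsetl _ _ _) Z0.
  exists n; last first.
    apply/(has_dim_inj (f := u)); first exact: subspace_act.
      by move=> x _; exact: mono0.
    by rewrite -kerE.
  by apply: (has_dim_uniq hZ0) Z0; apply: (has_dim_ker_image hZ0 dn); rewrite imE.
have [q qE] := ib_projection B j.
apply: (dim_ker_nabla qE th0P th1P ngE kI kng) (dim_hom _ _ _ sum0 pi0E) (dim_hom _ _ _ sum1 pi1E).
(* A map m with g o m = 0 factors through M. As [ib_E B j] is a quotient of C by [q], the factor m'
   is determined by a map from C to M, which is 0. *)
move=> m gm; have [m' m'E] : exists m' : HomC (ib_E B j) M, forall x, u (m' x) = m x.
  apply: hom_lift => // x; have [y yx] : exists y, u y = m x.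
    by apply/ug; rewrite -compCE gm.
  by exists y.
have m'q z : m' (q z) = 0 by rewrite -[LHS]/(compC m' q z) (CM (compC m' q)).
by apply: hom_eq => x; rewrite -m'E -(ib_projectionK qE x) m'q linear0.
Qed.

End Nabla.

(** * Duality and pointed coalgebras *)

Section Duality.
Variables (K : fieldType) (C : coalgebra K).

(** Under evaluation the action of e on T is adjoint to its action on D T, so the pairing restricts
    to the two images of e without acquiring a kernel. *)
Lemma dim_act_dual s (T : comodule C s) (X : comodule C (opp_side s)) (e : dual C) n :
  conv s e e = e -> is_D T X ->
  has_dim (range (act e : T -> T)) n <-> has_dim (range (act e : X -> X)) n.
Proof.
move=> ee [_ [th [lth thI thS thA]]].
have idem t (M : comodule C t) (x : M) : conv t e e = e -> range (act e) x -> act e x = x.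
  by move=> te [y _ <-]; rewrite -actM te.
have ee' : conv (opp_side s) e e = e by rewrite conv_opp.
have hb : bilin (fun (x : X) (t : T) => th x t : K^o).
  by split=> [t a x y|x a t t']; [rewrite lth dual_addE|rewrite dual_linear].
have hX := subspace_range (@act K C _ X e); have hT := subspace_range (@act K C _ T e).
have thE x t : th (act e x) t = th x (act e t) by rewrite thA.
have fl x : range (act e) x -> (forall t, range (act e) t -> th x t = 0) -> x = 0.
  move=> xr hx; apply: thI; rewrite [RHS](linear0 (to_linear lth)).
  apply: dual_ext => t; rewrite -(idem _ _ _ ee' xr) thE; apply: hx; by exists t.
have fr t : range (act e) t -> (forall x, range (act e) x -> th x t = 0) -> t = 0.
  move=> tr ht; apply: dual_separates0 => phi; have [x <-] := thS phi.
  by rewrite -(idem _ _ _ ee tr) -thE; apply: ht; exists x.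
by split=> h; [apply: (pairing_dim hb hX hT fl fr h)
  |apply: (pairing_dim (bilinC hb) hT hX fr fl h)].
Qed.

(** Every nonzero subcomodule of E contains the image of S, so two of them never meet in 0.
    Computability speaks of indecomposable injectives only. *)
Lemma envelope_indecomposable s (S E : comodule C s) (u : HomC S E) :
  simple S -> injective_envelope u -> indecomposable E.
Proof.
move=> [nz sS] [uI _ ess]; split=> [zE|P Q cP cQ _ PQ].
  by apply: nz => x; apply: (mono0 uI); exact: zE.
have full (R : set E) : subcomodule R -> R = [set 0] \/ range u `<=` R.
  move=> cR; have [E0|ET] := sS _ (subcomodule_preimage u cR); [left|right].
    apply/seteqP; split; last by move=> _ ->; exact: cR.1.1.
    apply: ess => // _ [[x _ <-] Rx].
    have : (u @^-1` R) x by [].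
    by rewrite E0 => ->; rewrite /= linear0.
  move=> _ [x _ <-]; have : [set: S] x by [].
  by rewrite -ET.
have [|uP] := full P cP; first by left.
have [|uQ] := full Q cQ; first by right.
exfalso; apply: nz => x; apply: (mono0 uI).
have : (P `&` Q) (u x) by split; [apply: uP|apply: uQ]; exists x.
by rewrite PQ.
Qed.

End Duality.

(** * One-dimensional comodules and grouplike elements *)

Section OneDimensional.
Variables (K : fieldType) (C : coalgebra K).

Lemma has_dim1 (V : lmodType K) : has_dim [set: V] 1 ->
  exists v : V, v <> 0 /\ forall x, exists a, x = a *: v.
Proof.
move=> /(has_dimP _ (subspaceT V))[v [_ fv sv]]; exists (v ord0); split=> [v0|x].
  have /eqP : (1 : K) = 0 by apply: (fv (fun=> 1) _ ord0); rewrite big_ord1 v0 scaler0.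
  by rewrite oner_eq0.
by have [a ->] := sv x Logic.I; exists (a ord0); rewrite big_ord1.
Qed.

Lemma line_simple s (M : comodule C s) (v : M) : v <> 0 -> (forall x, exists a, x = a *: v) ->
  simple M.
Proof.
move=> v0 hv; split=> [zM|P cP]; first exact: v0.
have [P0|] := pselect (P `<=` [set 0]).
  by left; apply/seteqP; split=> // _ ->; exact: cP.1.1.
move=> /existsNP[x /not_implyP[Px x0]]; right; apply/seteqP; split=> // y _.
have [a xE] := hv x; have [b ->] := hv y.
have a0 : a != 0 by apply/eqP => a0; apply: x0; rewrite xE a0 scale0r.
rewrite -[b](mulfVK a0) -scalerA -xE.
exact: (subspaceZ cP.1).
Qed.

Lemma line_coact s (M : comodule C s) (v : M) : (forall x, exists a, x = a *: v) ->
  exists g : C, coact M v = tmk g v.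
Proof.
move=> hv; have [n [c [x ->]]] := tens_sum_ord (coact M v).
have /choice[a xE] : forall i, exists a, x i = a *: v by move=> i; exact: hv.
exists (\sum_i a i *: c i); rewrite tmk_suml; apply: eq_bigr => i _.
by rewrite {1}xE tmkZr tmkZl.
Qed.

(* Both comodules are given by the same grouplike element [g]. *)
Lemma line_opp s (M : comodule C s) (v : M) : v <> 0 -> (forall x, exists a, x = a *: v) ->
  exists (g : C) (M' : comodule C (opp_side s)) (v' : M'),
    [/\ v' <> 0, forall x, exists a, x = a *: v',
        forall f : dual C, act f v = f g *: v &
        forall f : dual C, act f v' = f g *: v'].
Proof.
move=> v0 hv; have [g gE] := line_coact hv.
have actv (f : dual C) : act f v = f g *: v.
  by rewrite -[LHS]/(contract f (coact M v)) gE contractE.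
have cancel_v a b : a *: v = b *: v -> a = b.
  move=> /eqP; rewrite -subr_eq0 -scalerBl scaler_eq0 subr_eq0 => /orP[/eqP //|/eqP].
  by move=> /v0.
(* The element [g] is grouplike, so evaluation at [g] is a character of the convolution algebra. As
   K is commutative it is also a character for the opposite product, which yields the line on the
   other side. *)
have g1 : counit C g = 1 by apply: cancel_v; rewrite scale1r -[RHS]act1 actv.
have gM (f h : dual C) : conv s f h g = f g * h g.
  apply: cancel_v; rewrite -actv actM actv.
  by rewrite linearZ /= actv scalerA.
have lrho : linear (fun a : K^o => tmk g a) by move=> a x y; exact: (tmk_bilin _ _).2.
pose rho := to_linear lrho.
have r1 (m : K^o) : contract (conv1 C) (rho m) = m.
  by rewrite -[rho m]/(tmk g m) contractE -[dual_fun _ g]/(counit C g : K) g1 scale1r.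
have rM (f h : dual C) (m : K^o) :
    contract (conv (opp_side s) f h) (rho m) = contract h (rho (contract f (rho m))).
  rewrite -[rho m]/(tmk g m) contractE -[rho _]/(tmk g _) !contractE.
  by rewrite conv_opp gM scalerA.
exists g, (build_comodule r1 rM), 1; split.
- by apply/eqP; exact: oner_neq0.
- by move=> x; exists x; rewrite /GRing.scale /= mulr1.
- exact: actv.
- by move=> f; rewrite -[LHS]/(contract f (tmk g (1 : K^o))) contractE.
Qed.

Lemma line_isomorphic s (M N : comodule C s) (v : M) (w : N) (g : C) :
  v <> 0 -> (forall x, exists a, x = a *: v) -> w <> 0 -> (forall x, exists a, x = a *: w) ->
  (forall f : dual C, act f v = f g *: v) -> (forall f : dual C, act f w = f g *: w) ->
  isomorphic M N.
Proof.
move=> v0 hv w0 hw actv actw; have [al [alv _]] := dual_separates (subspace0 M) v0.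
have lF : linear (fun x => al x *: w).
  by move=> a x y; rewrite dual_linear scalerDl scalerA.
have aF (f : dual C) x : al (act f x) *: w = act f (al x *: w).
  have [a ->] := hv x; rewrite [act f (a *: v)]linearZ [act f (_ *: w)]linearZ /=.
  by rewrite actv actw !dualZ alv !mulr1 scalerA.
exists (mkHom lF aF); split.
  apply: mono_ker => x; have [a ->] := hv x; rewrite mkHomE dualZ alv mulr1 => /eqP.
  by rewrite scaler_eq0 => /orP[/eqP ->|/eqP //]; rewrite scale0r.
by move=> y; have [b ->] := hw y; exists (b *: v); rewrite mkHomE dualZ alv mulr1.
Qed.

End OneDimensional.

(** * The two injective bases and the Cartan numbers *)

Section Bases.
Variables (K : fieldType) (C : coalgebra K) (I : choiceType) (d : socle_data C I).

Definition left_basis : injective_basis C lside I :=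
  @InjectiveBasis K C lside I (sd_S d) (sd_E d) (sd_env d) (sd_e d)
    (fun j => sval (cid (sd_eC d j))) (sd_simple d)
    (fun T sT => let: ex_intro j (conj i _) := sd_repr d sT in ex_intro _ j i)
    (sd_envP d) (fun j => let: And3 i _ _ := sd_prim d j in i)
    (fun j => (svalP (cid (sd_eC d j))).1) (fun j => (svalP (cid (sd_eC d j))).2).

Definition cartan_dim (i j : I) : nat :=
  dimK (range (fun c => rmulC (lmulC (sd_e d i) c) (sd_e d j))).

Lemma subspace_cartan i j :
  subspace (range (fun c => rmulC (lmulC (sd_e d i) c) (sd_e d j))).
Proof.
split=> [|a _ _ [x _ <-] [y _ <-]].
  by exists 0 => //; rewrite /rmulC /lmulC !linear0.
by exists (a *: x + y) => //; rewrite /rmulC /lmulC !linearP.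
Qed.

Lemma cartan_image_left i j :
  (ib_u left_basis i : sd_E d i -> C) @` range (act (sd_e d j)) =
  range (fun c => rmulC (lmulC (sd_e d i) c) (sd_e d j)).
Proof.
have ru := ib_range left_basis i.
apply/seteqP; split=> [_ [_ [x _ <-] <-]|_ [c _ <-]].
  have : range (ib_u left_basis i : sd_E d i -> C) (ib_u left_basis i x) by exists x.
  rewrite ru => -[c _ cE]; exists c => //.
  by rewrite -act_hom /lmulC -cE.
have : range (cact rside (sd_e d i)) (cact rside (sd_e d i) c) by exists c.
rewrite -ru => -[x _ xE]; exists (act (sd_e d j) x); first by exists x.
by rewrite -act_hom xE.
Qed.

Hypothesis Ccomp : computable C.

(** Computability makes Hom (E(i), E(j)) finite-dimensional; its dimension is that of E(i) e_j,
    which is carried to e_i C e_j in C. Hence [cartan_dim] is a true dimension and not the default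
    value 0 of [dimK]. *)
Lemma dim_act_left i j :
  has_dim (range (act (sd_e d j) : sd_E d i -> sd_E d i)) (cartan_dim i j).
Proof.
have ind k : indecomposable (sd_E d k).
  exact: envelope_indecomposable (sd_simple d k) (sd_envP d k).
have inj k : injective_comod (sd_E d k) by have [] := sd_envP d k.
have [n /(dim_hom_act left_basis _ j)dn] := Ccomp (inj i) (ind i) (inj j) (ind j).
suff -> : cartan_dim i j = n by [].
apply: dimK_eq; first exact: subspace_cartan.
rewrite -cartan_image_left; apply/(has_dim_inj (f := ib_u left_basis i)); last exact: dn.
  exact: (subspace_act (sd_E d i)).
by move=> x _; apply: mono0; exact: (@ib_mono _ _ _ _ left_basis i).
Qed.

Lemma has_dim_cartan i j :
  has_dim (range (fun c => rmulC (lmulC (sd_e d i) c) (sd_e d j))) (cartan_dim i j).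
Proof.
rewrite -cartan_image_left; apply/(has_dim_inj (f := ib_u left_basis i)); last exact: dim_act_left.
  exact: (subspace_act (sd_E d i)).
by move=> x _; apply: mono0; exact: (@ib_mono _ _ _ _ left_basis i).
Qed.

Hypothesis Cpointed : pointed C.

Lemma Shat_line j : exists w : sd_Shat d j, w <> 0 /\ forall x, exists a, x = a *: w.
Proof.
apply: has_dim1; have [_ [th [lth thI thS _]]] := sd_D d j.
apply: (@pairing_dim _ _ _ (fun x t => th x t : K^o) _ _ _ _ (@subspaceT _ _) (@subspaceT _ _))
  (Cpointed (sd_simple d j)) => [|x _ hx|t _ ht].
- by split=> [t a x y|x a t t']; [rewrite lth dual_addE|rewrite dual_linear].
- apply: thI; rewrite [RHS](linear0 (to_linear lth)).
  by apply: dual_ext => t; exact: hx.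
- by apply: dual_separates0 => phi; have [x <-] := thS phi; exact: ht.
Qed.

Lemma Shat_simple j : simple (sd_Shat d j).
Proof. by have [w [w0 hw]] := Shat_line j; exact: line_simple hw. Qed.

(** A simple right comodule is a line given by a grouplike g. The left line of the same g is some
    S(j), and D S(j) is again a line on which the action is evaluation at g. *)
Lemma Shat_cover (T : comodule C rside) : simple T -> exists j, isomorphic T (sd_Shat d j).
Proof.
move=> sT; have [v [v0 hv]] := has_dim1 (Cpointed sT).
have [g [T' [v' [v'0 hv' actv actv']]]] := line_opp v0 hv.
have [j [[f [fI fS]] _]] := sd_repr d (line_simple v'0 hv').
exists j; have [w [w0 hw]] := Shat_line j.
apply: (line_isomorphic v0 hv w0 hw actv) => h.
have [_ [th [lth thI _ thA]]] := sd_D d j.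
have th0 : th 0 = 0 by exact: (linear0 (to_linear lth)).
have actS (y : sd_S d j) : act h y = h g *: y.
  have [x <-] := fS y; have [a ->] := hv' x; rewrite act_hom -linearZ; congr (f _).
  by rewrite linearZ /= actv' !scalerA mulrC.
apply: thI; apply: dual_ext => y; rewrite thA -[LHS]/(dual_fun (th w) (act h y)) actS.
by rewrite -[h g *: w]addr0 lth th0 dual_addE dualZ addr0.
Qed.

Definition right_basis : injective_basis C rside I :=
  @InjectiveBasis K C rside I (sd_Shat d) (sd_Ehat d) (sd_envhat d) (sd_e d)
    (fun j => sval (cid (sd_Ce d j))) Shat_simple Shat_cover (sd_envhatP d)
    (fun j => let: And3 i _ _ := sd_prim d j in etrans (conv_opp lside _ _) i)
    (fun j => (svalP (cid (sd_Ce d j))).1) (fun j => (svalP (cid (sd_Ce d j))).2).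

(** On C e_j the idempotent e_i acts by multiplication from the left, so the indices of the Cartan
    number come in the order opposite to that of [dim_act_left]. *)
Lemma dim_act_right i j :
  has_dim (range (act (sd_e d i) : sd_Ehat d j -> sd_Ehat d j)) (cartan_dim i j).
Proof.
apply/(has_dim_inj (f := ib_u right_basis j)).
- exact: (subspace_act (sd_Ehat d j)).
- by move=> x _; apply: mono0; exact: (@ib_mono _ _ _ _ right_basis j).
suff -> : ib_u right_basis j @` range (act (sd_e d i)) =
  range (fun c => rmulC (lmulC (sd_e d i) c) (sd_e d j)) by exact: has_dim_cartan.
have ru := ib_range right_basis j.
have swap c : rmulC (lmulC (sd_e d i) c) (sd_e d j) =
    cact rside (sd_e d i) (cact lside (sd_e d j) c).
  exact: (cactC lside).
apply/seteqP; split=> [_ [_ [x _ <-] <-]|_ [c _ <-]].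
  have : range (ib_u right_basis j : sd_Ehat d j -> C) (ib_u right_basis j x) by exists x.
  rewrite ru => -[c _ cE]; exists c => //.
  by rewrite swap -act_hom -cE.
have : range (cact lside (sd_e d j)) (cact lside (sd_e d j) c) by exists c.
rewrite -ru => -[x _ xE]; exists (act (sd_e d i) x); first by exists x.
by rewrite swap -act_hom xE.
Qed.

End Bases.

(** * Dimension vectors *)

Section Vectors.
Variables (I : choiceType).
Implicit Types (ks ls : seq I) (A : I -> I -> int).

Definition lcomb (x : I -> I -> int) ks ls : I -> int :=
  fun j => \sum_(k <- ks) x k j - \sum_(k <- ls) x k j.

(** The support of x may be infinite. Finiteness of the column of A keeps the sum away from the
    default value 0 of infinite sums, and hence additive in x. *)
Lemma vmul_fin (x : I -> int) A j : finite_set [set i | A i j != 0] ->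
  vmul x A j = \sum_(i <- finmap.enum_fset (fset_set [set i | A i j != 0])) x i * A i j.
Proof.
move=> fA; rewrite /vmul; apply: fsbigTE => i; rewrite in_fset_set // => /negP h.
suff -> : A i j = 0 by rewrite mulr0.
by apply: contrapT => /eqP ij; apply: h; rewrite inE.
Qed.

Lemma vmul_lcomb (x : I -> I -> int) ks ls A j : finite_set [set i | A i j != 0] ->
  vmul (lcomb x ks ls) A j = \sum_(k <- ks) vmul (x k) A j - \sum_(k <- ls) vmul (x k) A j.
Proof.
move=> fA; rewrite vmul_fin //.
have e ms : \sum_(k <- ms) vmul (x k) A j =
    \sum_(i <- finmap.enum_fset (fset_set [set i | A i j != 0])) (\sum_(k <- ms) x k i) * A i j.
  under eq_bigr => k _ do rewrite vmul_fin //.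
  by rewrite exchange_big; apply: eq_bigr => i _; rewrite mulr_suml.
by rewrite !e -sumrB; apply: eq_bigr => i _; rewrite mulrBl.
Qed.

(** Here the vector has finite support, so the columns of A may be infinite, as those of the Cartan
    matrix can be. *)
Lemma vmul_delta ks ls A j :
  vmul (lcomb (fun k i => (k == i)%:Z) ks ls) A j = lcomb A ks ls j.
Proof.
pose r := undup (ks ++ ls).
have sum_delta (ms : seq I) : {subset ms <= r} ->
    \sum_(i <- r) (\sum_(k <- ms) (k == i)%:Z) * A i j = \sum_(k <- ms) A k j.
  move=> msr; under eq_bigr => i _ do rewrite mulr_suml.
  rewrite exchange_big /= big_seq [RHS]big_seq; apply: eq_bigr => k /msr kr.
  rewrite (bigD1_seq k) ?undup_uniq //= eqxx mul1r big1 ?addr0 // => i.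
  by rewrite eq_sym => /negbTE ->; rewrite mul0r.
rewrite /vmul (fsbigE r) ?undup_uniq //; last first.
  move=> i _; rewrite mem_undup mem_cat negb_or => /andP[ik il].
  rewrite /lcomb !big_seq !big1 ?subrr ?mul0r // => k kin.
    by case: eqP il => // <-; rewrite kin.
  by case: eqP ik => // <-; rewrite kin.
under eq_bigl => i do rewrite in_setT.
under eq_bigr => i _ do rewrite mulrBl.
by rewrite sumrB !sum_delta // => k kin; rewrite mem_undup mem_cat kin ?orbT.
Qed.

Lemma subgroup_lcomb (G : set (I -> int)) (x : I -> I -> int) ks ls :
  is_subgroup G -> (forall k, G (x k)) -> G (lcomb x ks ls).
Proof.
move=> [G0 GB] Gx.
have GN y : G y -> G (- y) by move=> Gy; rewrite -[- y]add0r; exact: GB.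
have GD y z : G y -> G z -> G (y + z).
  by move=> Gy Gz; rewrite -[z]opprK; apply: GB => //; exact: GN.
have Gsum ms : G (fun j => \sum_(k <- ms) x k j).
  elim: ms => [|k ms IH].
    by rewrite (_ : (fun _ => _) = 0) //; apply/funext => j; rewrite big_nil.
  rewrite (_ : (fun _ => _) = x k + (fun j => \sum_(k <- ms) x k j)); first exact: GD.
  by apply/funext => j; rewrite big_cons.
exact: GB.
Qed.

Lemma lcombN (x : I -> I -> int) ks ls : - lcomb x ks ls = lcomb x ls ks.
Proof. by apply/funext => j; exact: opprB. Qed.

End Vectors.

Lemma dimvecE (K : fieldType) (C : coalgebra K) (I : choiceType) (d : socle_data C I)
    (M : comodule C lside) j n :
  has_dim (range (act (sd_e d j) : M -> M)) n -> dimvec d M j = n%:Z.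
Proof.
by move=> dn; congr Posz; apply: dimK_eq dn; exact: (subspace_act M (sd_e d j)).
Qed.

Lemma nat_subz (n a b : nat) : (n + a)%N = b -> n%:Z = b%:Z - a%:Z.
Proof. by move=> <-; rewrite PoszD addrK. Qed.

Lemma Posz_sum (J : Type) (r : seq J) (F : J -> nat) :
  (\sum_(k <- r) F k)%N%:Z = \sum_(k <- r) (F k)%:Z.
Proof. exact: (big_morph Posz PoszD erefl). Qed.

(** * Coxeter transformations on combinations of Cartan rows and columns *)

Section CoxeterTransformations.
Variables (K : fieldType) (C : coalgebra K) (I : choiceType) (d : socle_data C I).
Variables (cinv : I -> I -> int) (cinvP : is_cartan_inverse d cinv).

(** The inverse matrix turns each Cartan row into a unit vector, the sums being finite by its
    column-finiteness; the second product then only selects rows of the transpose. The sign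
    exchanges the two lists. *)
Lemma Phi_minus_lcomb ks ls :
  Phi_minus d cinv (lcomb (cartan d) ks ls) = lcomb (mtr (cartan d)) ls ks.
Proof.
have [_ fin_col cart_inv _ _] := cinvP.
rewrite /Phi_minus (_ : vmul _ cinv = lcomb (fun k i => (k == i)%:Z) ks ls).
  by rewrite -[RHS]lcombN; congr (- _); apply/funext => j; exact: vmul_delta.
apply/funext => j; rewrite vmul_lcomb; last exact: fin_col.
by rewrite /lcomb; congr (_ - _); apply: eq_bigr => k _; rewrite cart_inv.
Qed.

(** After transposition the other inverse identity is the relevant one, together with row-finiteness
    of the inverse. *)
Lemma Phi_lcomb ks ls :
  Phi d cinv (lcomb (mtr (cartan d)) ks ls) = lcomb (cartan d) ls ks.
Proof.
have [fin_row _ _ inv_cart _] := cinvP.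
rewrite /Phi (_ : vmul _ (mtr cinv) = lcomb (fun k i => (k == i)%:Z) ks ls).
  by rewrite -[RHS]lcombN; congr (- _); apply/funext => j; exact: vmul_delta.
apply/funext => j; rewrite vmul_lcomb; last exact: fin_row.
have e k : vmul (mtr (cartan d) k) (mtr cinv) j = (k == j)%:Z.
  rewrite eq_sym -inv_cart; apply: eq_fsbigr => i _.
  by rewrite /mtr mulrC.
by rewrite /lcomb; congr (_ - _); apply: eq_bigr => k _; rewrite e.
Qed.

End CoxeterTransformations.

Theorem theorem3p4 (K : fieldType) (C : coalgebra K)
    (C_pointed : pointed C) (C_sharp : sharp_Euler C)
    (I : choiceType) (d : socle_data C I)
    (cinv : I -> I -> int) (cinvP : is_cartan_inverse d cinv) :
  (forall (M M' X : comodule C lside) (f : HomC M M') (g : HomC M' X),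
     indecomposable M -> Comod_fc_bullet M -> inj_dim M 1 ->
     (forall h : HomC (regular C lside) M, h = 0) ->
     is_tau_minus M X -> indecomposable X -> comod_fP X ->
     unique_almost_split_from (@Comod_fc K C lside) f g ->
     Z_left d (dimvec d M) /\
     dimvec d X = Phi_minus d cinv (dimvec d M)) /\
  (forall (X N' N : comodule C lside) (DN : comodule C rside)
          (f : HomC X N') (g : HomC N' N),
     indecomposable N -> ~ projective_comod N -> comod_fP N ->
     is_tau N DN X -> inj_dim DN 1 ->
     (forall h : HomC (regular C rside) DN, h = 0) ->
     indecomposable X -> Comod_fc_bullet X ->
     unique_almost_split_to (@Comod_fc K C lside) f g ->
     Z_right d (dimvec d N) /\
     dimvec d X = Phi d cinv (dimvec d N)).
Proof.
have Ccomp : computable C by case: C_sharp => -[].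
have idem j : conv lside (sd_e d j) (sd_e d j) = sd_e d j by case: (sd_prim d j).
have idem' j : conv rside (sd_e d j) (sd_e d j) = sd_e d j by rewrite -[RHS]idem (conv_opp lside).
split=> [M M' X f g _ _ M1 CM [T [TrM DT]] _ _ _|X N' N DN f g _ _ _ [DNP TrDN] DN1 CDN _ _ _].
  have [ks0 [ks1 dims]] :=
    transpose_dims (B := left_basis d) (dim_act_left d Ccomp) TrM M1 CM.
  have dimM : dimvec d M = lcomb (cartan d) ks0 ks1.
    apply/funext => j; have [[n nE dn] _] := dims j.
    by rewrite (dimvecE dn) (nat_subz nE) !Posz_sum.
  have dimX : dimvec d X = lcomb (mtr (cartan d)) ks1 ks0.
    apply/funext => j; have [_ [n nE dn]] := dims j.
    have dn' := (dim_act_dual (s := rside) n (idem' j) DT).1 dn.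
    by rewrite (dimvecE dn') (nat_subz nE) !Posz_sum.
  split; last by rewrite dimX dimM (Phi_minus_lcomb cinvP).
  (* The rows of the Cartan matrix are the generators dim E(k) of the domain of [Phi_minus]. *)
  rewrite dimM => G [sG EG]; apply: subgroup_lcomb => // k; apply: EG; exists k => //.
  by apply/funext => j; rewrite (dimvecE (dim_act_left d Ccomp k j)).
(* The right comodule D N now plays the role of M, and its transpose is X itself; N has the same
   dimension vector as D N by [dim_act_dual]. *)
have [ks0 [ks1 dims]] := transpose_dims (B := right_basis d C_pointed)
   (fun j i => dim_act_right d Ccomp C_pointed i j) TrDN DN1 CDN.
have dimN : dimvec d N = lcomb (mtr (cartan d)) ks0 ks1.
  apply/funext => j; have [[n nE dn] _] := dims j.
  have dn' := (dim_act_dual (s := lside) n (idem j) DNP).2 dn.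
  by rewrite (dimvecE dn') (nat_subz nE) !Posz_sum.
have dimX : dimvec d X = lcomb (cartan d) ks1 ks0.
  apply/funext => j; have [_ [n nE dn]] := dims j.
  by rewrite (dimvecE dn) (nat_subz nE) !Posz_sum.
split; last by rewrite dimX dimN (Phi_lcomb cinvP).
rewrite dimN => G [sG EG]; apply: subgroup_lcomb => // k; apply: EG; exists k => //.
(* Vectors of right comodules are defined by maps into the injectives, so [dim_hom_act] is used to
   recognise a Cartan column as dim of the k-th right injective. *)
apply/funext => j; congr Posz; apply: dimK_eq; first exact: subspaceT.
by apply/(dim_hom_act (right_basis d C_pointed) _ j); exact: dim_act_right.
Qed.
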